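(* Let $X$ be an SMD random variable such that $K_{2n}(X)>0$ for every integer $n\ge1$. If $Y$ is a centred real random variable admitting moments of all orders such that $\mathit{mmse}(X,s)=\mathit{mmse}(Y,s)$ for all $s>0$, then $X$ and $Y$ have the same distribution.
   Context: For a real random variable $X$ with moments of all orders, its cumulants are $K_n(X)=(-i)^n(\ln\varphi_X)^{(n)}(0)$, $\varphi_X$ the characteristic function. $X$ is called SMD if $X$ and $-X$ have the same law, $X$ has moments of all orders, and any random variable $Y$ with $\mathbb{E}[Y^p]=\mathbb{E}[X^p]$ for all $p\ge1$ has the same law as $X$. For $s>0$, $\mathit{mmse}(X,s)=\mathbb{E}[(X-\mathbb{E}[X\mid Y_s])^2]$ where $Y_s=\sqrt{s}X+N$ and $N$ is a standard Gaussian independent of $X$. *)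

(* Defs.v *)
From HB Require Import structures.
From mathcomp Require Import all_boot all_order all_algebra.
From mathcomp Require Import all_classical all_reals all_analysis.
Set Implicit Arguments. Unset Strict Implicit. Unset Printing Implicit Defensive.
Import Order.TTheory GRing.Theory Num.Theory.
Import numFieldNormedType.Exports.
Local Open Scope classical_set_scope.
Local Open Scope ring_scope.

Section defs.
Context {R : realType}.

(* Laws of real random variables are probability measures on R. *)

Definition moment (mu : set R -> \bar R) (p : nat) : \bar R :=
  (\int[mu]_x (x ^+ p)%:E)%E.

Definition has_all_moments (mu : set R -> \bar R) : Prop :=
  forall p : nat, mu.-integrable setT (fun x => (x ^+ p)%:E).

Definition symmetric_law (mu : set R -> \bar R) : Prop :=
  forall A : set R, measurable A -> mu ((fun x => - x) @^-1` A) = mu A.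

Definition moment_determinate (mu : set R -> \bar R) : Prop :=
  forall nu : probability R R,
    (forall p : nat, (1 <= p)%N ->
       nu.-integrable setT (fun x => (x ^+ p)%:E) /\ moment nu p = moment mu p) ->
    forall A : set R, measurable A -> nu A = mu A.

Definition SMD (mu : set R -> \bar R) : Prop :=
  [/\ symmetric_law mu, has_all_moments mu & moment_determinate mu].

(* Characteristic function of a SYMMETRIC law: phi(t) = E[e^{itX}] = E[cos(tX)]
   (the imaginary part E[sin(tX)] vanishes by symmetry), so phi is real. *)
Definition charfun_sym (mu : set R -> \bar R) (t : R) : R :=
  fine (\int[mu]_x (cos (t * x))%:E)%E.

(* Even cumulant K_{2n} = (-i)^{2n} (ln phi)^{(2n)}(0) = (-1)^n (ln phi)^{(2n)}(0)
   for a symmetric law (phi real, phi(0) = 1 > 0). *)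
Definition even_cumulant_sym (mu : set R -> \bar R) (n : nat) : R :=
  (-1) ^+ n * derive1n (2 * n)%N (fun t => ln (charfun_sym mu t)) 0.

(* Gaussian channel: on the canonical space (R * R, law(X) \x N(0,1)),
   the pair z = (x, w) with X := z.1, N := z.2 independent, and
   Y_s := sqrt s * X + N. *)
Definition gauss : set R -> \bar R := @normal_prob R 0 1.

Definition chan (s : R) (z : R * R) : R := Num.sqrt s * z.1 + z.2.

Definition joint (mu : set R -> \bar R) : set (R * R) -> \bar R :=
  (mu \x gauss)%E.

Definition is_condexp (mu : set R -> \bar R) (s : R) (g : R -> R) : Prop :=
  [/\ measurable_fun setT g,
      (joint mu).-integrable setT (fun z => (g (chan s z))%:E) &
      forall B : set R, measurable B ->
        (\int[joint mu]_(z in chan s @^-1` B) (z.1)%:E =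
         \int[joint mu]_(z in chan s @^-1` B) (g (chan s z))%:E)%E].

Definition condexp (mu : set R -> \bar R) (s : R) : R -> R :=
  match pselect (exists g, is_condexp mu s g) with
  | left H => projT1 (cid H)
  | right _ => fun _ => 0
  end.

Definition mmse (mu : set R -> \bar R) (s : R) : \bar R :=
  (\int[joint mu]_z ((z.1 - condexp mu s (chan s z)) ^+ 2)%:E)%E.

End defs.

(* Main.v *)
Require Import Defs.
From HB Require Import structures.
From mathcomp Require Import all_boot all_order all_algebra.
From mathcomp Require Import all_classical all_reals all_analysis.
From mathcomp Require Import measurable_realfun.
From mathcomp Require Import ring lra zify.
Import Order.TTheory GRing.Theory Num.Theory.
Import numFieldNormedType.Exports.
Local Open Scope classical_set_scope.
Local Open Scope ring_scope.

(* Write u_i for minus the (i+1)-st cumulant of the posterior law of X given Y_s. In the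
   innovation (stochastic localisation) picture, a polynomial in the u_i evolves
   under a generator H/2 whose coefficients on monomials are nonnegative, and
   mmse(X, s) = - E[u_1]. Iterating, the Taylor coefficients of mmse at s = 0+ are the
   values of H^k u_1 at the cumulants of X itself, up to the factor - 1 / (2^k k!); only
   moments enter the remainder estimate, so the expansion passes from truncations of X to X.

   Monomials of H^k u_1 behave like 2-connected multigraphs with k+1 edges: the only one
   involving u_k or beyond is u_k^2, so mmse determines the squares of the cumulants
   inductively. If an even cumulant of Y had the wrong sign, then in the next
   coefficient every term would change in the same direction, and strictly so because
   the even cumulants of X are positive; for the fourth cumulant this needs three more
   coefficients, computed explicitly. Hence X and Y have the same cumulants, the same
   moments, and the same law. *)

(** The parameter is r = sqrt(s), and posterior monomials are multiplied by the density [Z] of the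
    observation and averaged against the fixed standard Gaussian. Multiplying the likelihood by x or
    by x^2 then acts linearly on [Z] times a monomial, through operators A and A^2 - H; this is
    where H comes from. The obstacle is that X has moments only, whereas differentiation under the
    Gaussian integral and Stein's identity are run with exponential bounds, which bounded signals
    provide. What survives the removal of the bound is an estimate by moments: a posterior monomial
    of total degree d is at most a constant times the d-th absolute posterior moment, since
    Chebyshev's association inequality merges products of moments into one; weighted by [Z] and
    averaged, that moment is exactly E|X|^d, whatever r is. *)

(** * Binomial convolution and the moment-cumulant recursion *)

Section binomial_convolution.
Context {K : comNzRingType}.
Implicit Types u v w m : nat -> K.

Definition bshift u : nat -> K := fun n => u n.+1.

(** The coefficients of a product of exponential generating series, defined by the Leibniz rule:
    [bshift] is differentiation and a derivation by construction, so associativity and the flow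
    identities need no manipulation of binomial coefficients. *)
Fixpoint bconv u v n : K :=
  if n is n'.+1 then bconv (bshift u) v n' + bconv u (bshift v) n' else u 0%N * v 0%N.

Lemma bconvC u v n : bconv u v n = bconv v u n.
Proof.
elim: n u v => [|n IH] u v /=; first exact: mulrC.
by rewrite addrC; congr (_ + _); exact: IH.
Qed.

Lemma bconv_addl u v w n : bconv (fun i => u i + v i) w n = bconv u w n + bconv v w n.
Proof.
elim: n u v w => [|n IH] u v w /=; first exact: mulrDl.
by rewrite /bshift IH IH addrACA.
Qed.

Lemma bconv_scalel a u w n : bconv (fun i => a * u i) w n = a * bconv u w n.
Proof.
elim: n u w => [|n IH] u w /=; first by rewrite mulrA.
by rewrite /bshift IH IH mulrDr.
Qed.

Lemma bconv_addr u v w n : bconv w (fun i => u i + v i) n = bconv w u n + bconv w v n.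
Proof. by rewrite bconvC bconv_addl -!(bconvC w). Qed.

Lemma bconv_scaler a u w n : bconv w (fun i => a * u i) n = a * bconv w u n.
Proof. by rewrite bconvC bconv_scalel -(bconvC w). Qed.

Lemma bconvA u v w n : bconv u (bconv v w) n = bconv (bconv u v) w n.
Proof.
elim: n u v w => [|n IH] u v w /=; first exact: mulrA.
have sE x y : bshift (bconv x y) = fun i => bconv (bshift x) y i + bconv x (bshift y) i by [].
by rewrite !sE bconv_addl bconv_addr !IH addrA.
Qed.

Lemma eq_bconvl u v w n : v =1 w -> bconv v u n = bconv w u n.
Proof. by move=> /funext ->. Qed.

Lemma bconvE u v n : bconv u v n = \sum_(j < n.+1) 'C(n, j)%:R * u j * v (n - j)%N.
Proof.
elim: n u v => [|n IH] u v /=; first by rewrite big_ord1 bin0 mul1r.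
rewrite !IH big_ord_recl [in RHS]big_ord_recl /= !bin0 !mul1r !subn0.
rewrite [X in _ + X](_ : _ = u 0%N * v n.+1 + \sum_(i < n) 'C(n, i.+1)%:R * u i.+1 * v (n - i)%N); last first.
  rewrite big_ord_recl /= bin0 mul1r subn0; congr (_ + _); apply: eq_bigr => i _.
  by rewrite /bshift /bump /= add1n subnSK.
rewrite addrCA; congr (_ + _).
have -> : bshift u 0%N * v n + \sum_(i < n) 'C(n, bump 0 i)%:R * bshift u (bump 0 i) * v (n - bump 0 i)%N = \sum_(i < n.+1) 'C(n, i)%:R * u i.+1 * v (n - i)%N.
  by rewrite big_ord_recl /= bin0 mul1r subn0.
rewrite [X in _ + X = _](_ : _ = \sum_(i < n.+1) 'C(n, i.+1)%:R * u i.+1 * v (n - i)%N); last first.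
  by rewrite big_ord_recr /= bin_small // !mul0r addr0.
rewrite -big_split /=; apply: eq_bigr => i _.
by rewrite /bump /= add1n binS subSS natrD addrC !mulrDl.
Qed.

Lemma bconv_recl u v n :
  bconv u v n = u n * v 0%N + \sum_(j < n) 'C(n, j)%:R * u j * v (n - j)%N.
Proof. by rewrite bconvE big_ord_recr /= binn subnn mul1r addrC. Qed.

(** Convolution with m is triangular, with diagonal entries m_0 = 1. *)
Lemma bconv_inj m u v : m 0%N = 1 -> bconv u m =1 bconv v m -> u =1 v.
Proof.
move=> m0 uv n; have [k] := ubnP n; elim: k n => // k IH n; rewrite ltnS => nk.
move: (uv n); rewrite !bconv_recl m0 !mulr1.
rewrite (eq_bigr (fun j : 'I_n => 'C(n, j)%:R * v j * m (n - j)%N)) => [/addIr//|j _].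
by rewrite IH// (leq_trans (ltn_ord j)).
Qed.

(* The cumulants [k] of a moment sequence [m] satisfy [m' = k' * m] for the binomial
   convolution; [ncum m n] is [- k n.+1]. With this sign the flow of
   posterior cumulants has nonnegative coefficients. *)
Fixpoint ncums m n : seq K :=
  if n is k.+1 then
    let s := ncums m k in
    rcons s (- m k.+1 - \sum_(j < k) 'C(k, j)%:R * s`_j * m (k - j)%N)
  else [::].

Definition ncum m n : K := (ncums m n.+1)`_n.

Lemma size_ncums m n : size (ncums m n) = n.
Proof. by elim: n => //= n IH; rewrite size_rcons IH. Qed.

Lemma nth_ncums m n j : (j < n)%N -> (ncums m n)`_j = ncum m j.
Proof.
elim: n => // n IH; rewrite ltnS leq_eqVlt => /predU1P[-> //|jn].
by rewrite /= nth_rcons size_ncums jn IH.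
Qed.

Lemma ncumE m n :
  ncum m n = - m n.+1 - \sum_(j < n) 'C(n, j)%:R * ncum m j * m (n - j)%N.
Proof.
rewrite /ncum /= nth_rcons size_ncums ltnn eqxx; congr (_ - _).
by apply: eq_bigr => j _; rewrite nth_ncums.
Qed.

Lemma bshift_ncum m : m 0%N = 1 -> forall n, bshift m n = - bconv (ncum m) m n.
Proof. by move=> m0 n; rewrite bconv_recl m0 mulr1 {1}ncumE subrK opprK. Qed.

Lemma ncum_unique m u : m 0%N = 1 -> (forall n, m n.+1 = - bconv u m n) -> u =1 ncum m.
Proof.
by move=> m0 mu; apply: (bconv_inj m) => // n; apply: oppr_inj; rewrite -mu -bshift_ncum.
Qed.

Lemma ncum_inj m m' : m 0%N = 1 -> m' 0%N = 1 -> ncum m =1 ncum m' -> m =1 m'.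
Proof.
move=> m0 m'0 mm' n; have [k] := ubnP n; elim: k n => // k IH [_|n]; first by rewrite m0 m'0.
rewrite ltnS => nk; have := bshift_ncum m m0 n; have := bshift_ncum m' m'0 n; rewrite /bshift => -> ->.
congr (- _); rewrite !bconvE; apply: eq_bigr => j _; rewrite mm' IH//.
by rewrite (leq_ltn_trans (leq_subr _ _)).
Qed.

(* If the moments evolve by [m_n' = a (m_{n+1} - m_1 m_n) + b (m_{n+2} - m_2 m_n)],
   this is the resulting linearised equation for [v = u']. *)
Lemma ncum_flow m a b (u := ncum m)
    (v := fun n => a * u n.+1 + b * (u n.+2 - bconv u u n.+1))
    (dm := fun n => a * (m n.+1 - m 1%N * m n) + b * (m n.+2 - m 2%N * m n)) :
  m 0%N = 1 -> forall n, dm n.+1 = - (bconv v m n + bconv u dm n).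
Proof.
move=> m0 n.
have mS : forall n, m n.+1 = - bconv u m n by exact: bshift_ncum.
have smE : bshift m = fun i => -1 * bconv u m i by apply/funext => i; rewrite mulN1r; exact: mS.
have dmE : dm = fun i => (a * bshift m i + (- (a * m 1%N)) * m i) +
   (b * bshift (bshift m) i + (- (b * m 2%N)) * m i) by apply/funext => i; rewrite /dm /bshift; ring.
have vE : v = fun i => a * bshift u i + (b * bshift (bshift u) i + (- b) * (2%:R * bconv u (bshift u) i)).
  by apply/funext => i; rewrite /v /= [bconv (bshift u) u i]bconvC /bshift; ring.
rewrite {2}dmE vE !bconv_addl !bconv_addr !bconv_scalel !bconv_scaler.
have ssE : bconv u (bshift m) n = - bconv (bconv u u) m n.
  by rewrite smE bconv_scaler bconvA mulN1r.
have m1E : bconv u m n = - m n.+1 by rewrite mS opprK.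
have m2E : bconv (bshift u) m n = - m n.+2 - bconv u (bshift m) n.
  by rewrite mS /= opprK addrK.
have m3E : m n.+3 = - (bconv (bshift (bshift u)) m n + 2%:R * bconv (bshift u) (bshift m) n + bconv u (bshift (bshift m)) n).
  by rewrite mS /=; ring.
have c3 : bconv (bshift u) (bshift m) n = - bconv (bconv u (bshift u)) m n.
  rewrite smE bconv_scaler bconvA mulN1r; congr (- _).
  by apply: eq_bconvl => i; exact: bconvC.
rewrite /dm m3E m1E m2E c3; ring.
Qed.

End binomial_convolution.

(** * The generator on monomials and on polynomials *)

Section cumulant_flow.
Context {K : comNzRingType}.
Implicit Types (u v : nat -> K) (a b : seq nat).

Definition mprod u a : K := \prod_(i <- a) u i.

Lemma mprod_cons u n a : mprod u (n :: a) = u n * mprod u a.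
Proof. exact: big_cons. Qed.

(** The Leibniz rule for the derivation sending each factor n to n + 1, one term per factor. *)
Fixpoint dmon a : seq (seq nat) :=
  if a is n :: a' then (n.+1 :: a') :: map (cons n) (dmon a') else [::].

(* Twice the generator of the posterior cumulants (with their signs reversed) along the
   Gaussian channel, applied to a monomial: each factor splits, and each pair
   of factors is raised. The extremal splittings are compensated by
   the change of the weight [Z]. *)
Fixpoint Hmon a : seq (nat * seq nat) :=
  if a is n :: a' then
    [seq (t.1, n :: t.2) | t <- Hmon a'] ++
    [seq ('C(n.+1, j), [:: j, (n.+1 - j)%N & a']) | j <- iota 1 n] ++
    [seq (2%N, n.+1 :: b) | b <- dmon a']
  else [::].

(** On [Z] times a monomial this is the effect of multiplying the likelihood by x: each u_n moves to
    u_{n+1}, and [Z] is multiplied by -u_0, the posterior mean. The operators act on functions of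
    monomials, so that they pass through integrals and limits. *)
Definition Amap (f : seq nat -> K) a : K := \sum_(b <- dmon a) f b - f (0%N :: a).
Definition Hmap (f : seq nat -> K) a : K := \sum_(t <- Hmon a) t.1%:R * f t.2.

Fixpoint mderiv v u a : K :=
  if a is n :: a' then v n * mprod u a' + u n * mderiv v u a' else 0.

Lemma mderiv_bshift u a : mderiv (bshift u) u a = \sum_(b <- dmon a) mprod u b.
Proof.
elim: a => [|n a IH] /=; first by rewrite big_nil.
rewrite big_cons big_map mprod_cons IH mulr_sumr; congr (_ + _).
by apply: eq_bigr => b _; rewrite mprod_cons.
Qed.

Lemma Amap_mprod u a : Amap (mprod u) a = mderiv (bshift u) u a - u 0%N * mprod u a.
Proof. by rewrite /Amap mderiv_bshift mprod_cons. Qed.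

Lemma Hmap_mprod_cons u n a : Hmap (mprod u) (n :: a) =
  u n * Hmap (mprod u) a + (bconv u u n.+1 - 2%:R * u 0%N * u n.+1) * mprod u a
  + 2%:R * u n.+1 * mderiv (bshift u) u a.
Proof.
rewrite /Hmap /= !big_cat /= !big_map /= -addrA; congr (_ + (_ + _)).
- by rewrite mulr_sumr; apply: eq_bigr => t _; rewrite mprod_cons mulrCA.
- have -> : bconv u u n.+1 - 2%:R * u 0%N * u n.+1 =
    \sum_(j < n) 'C(n.+1, j.+1)%:R * u j.+1 * u (n - j)%N.
    rewrite bconvE big_ord_recl big_ord_recr /= bin0 subn0 /bump /= add1n binn subnn.
    rewrite (eq_bigr (fun j : 'I_n => 'C(n.+1, j.+1)%:R * u j.+1 * u (n - j)%N)); first by ring.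
    by move=> j _; rewrite add1n subSS.
  rewrite mulr_suml -[iota 1 n]/(iota (1 + 0) n) iotaDl big_map.
  have -> : iota 0 n = index_iota 0 n by rewrite /index_iota subn0.
  rewrite big_mkord.
  by apply: eq_bigr => j _; rewrite !mprod_cons add1n subSS !mulrA.
- rewrite mderiv_bshift mulr_sumr; apply: eq_bigr => b _.
  by rewrite mprod_cons mulrA.
Qed.

(** The right side is the effect of multiplying the likelihood by x^2: u_0^2 - u_1 is the second
    posterior moment, by which [Z] is multiplied, and the derivation is the second-order flow of the
    cumulants. Thus H is what applying A twice leaves beyond that flow. *)
Lemma Amap2_mprod u a : Amap (Amap (mprod u)) a - Hmap (mprod u) a =
  (u 0%N ^+ 2 - u 1%N) * mprod u a
  + mderiv (fun n => u n.+2 - bconv u u n.+1) u a.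
Proof.
pose d1 := mderiv (bshift u) u.
have d1E n b : d1 (n :: b) = u n.+1 * mprod u b + u n * d1 b by [].
have AE b : Amap (mprod u) b = d1 b - u 0%N * mprod u b by exact: Amap_mprod.
have -> : Amap (Amap (mprod u)) a = \sum_(b <- dmon a) d1 b - 2%:R * u 0%N * d1 a
    - u 1%N * mprod u a + u 0%N ^+ 2 * mprod u a.
  rewrite {1}/Amap AE mprod_cons /= (eq_bigr (fun b => d1 b - u 0%N * mprod u b)); last by move=> b _; exact: AE.
  rewrite sumrB -mulr_sumr -mderiv_bshift -/d1 d1E.
  ring.
suff : \sum_(b <- dmon a) d1 b - 2%:R * u 0%N * d1 a - Hmap (mprod u) a =
   mderiv (fun n => u n.+2 - bconv u u n.+1) u a by move=> <-; ring.
elim: a => [|n a IH]; first by rewrite /Hmap /d1 /= !big_nil mulr0 !subr0.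
rewrite Hmap_mprod_cons -/d1 [mderiv _ _ _]/= -IH /= big_cons big_map.
rewrite !d1E (eq_bigr (fun b => u n.+1 * mprod u b + u n * d1 b)) //.
rewrite big_split /= -!mulr_sumr -mderiv_bshift -/d1 /=; ring.
Qed.

Definition peval u (p : seq (nat * seq nat)) : K := \sum_(t <- p) t.1%:R * mprod u t.2.

(** The transpose of [Hmap], acting on polynomials stored as lists of coefficients and monomials;
    the shape of the monomials in its iterates can be studied combinatorially. *)
Definition Hpol (p : seq (nat * seq nat)) : seq (nat * seq nat) :=
  flatten [seq [seq ((t.1 * x.1)%N, x.2) | x <- Hmon t.2] | t <- p].

Lemma sum_Hpol (f : seq nat -> K) p :
  \sum_(t <- Hpol p) t.1%:R * f t.2 = \sum_(t <- p) t.1%:R * Hmap f t.2.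
Proof.
rewrite /Hpol big_flatten /= big_map; apply: eq_bigr => t _.
by rewrite big_map mulr_sumr; apply: eq_bigr => x _; rewrite /= natrM mulrA.
Qed.

(** Merging equal monomials keeps the lists short when the fifth and sixth iterates are computed
    explicitly. *)
Fixpoint pins c a (p : seq (nat * seq nat)) :=
  if p is t :: p' then
    if t.2 == a then ((t.1 + c)%N, a) :: p' else t :: pins c a p'
  else [:: (c, a)].

Definition pcollect (p : seq (nat * seq nat)) := foldr (fun t q => pins t.1 t.2 q) [::] p.

Lemma sum_pcollect (f : seq nat -> K) p :
  \sum_(t <- pcollect p) t.1%:R * f t.2 = \sum_(t <- p) t.1%:R * f t.2.
Proof.
have pinsE c a q : \sum_(t <- pins c a q) t.1%:R * f t.2 = c%:R * f a + \sum_(t <- q) t.1%:R * f t.2.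
  elim: q => [|t q IH] /=; first by rewrite big_cons.
  case: eqP => [<-|_]; rewrite !big_cons /=; first by rewrite natrD; ring.
  by rewrite IH addrCA.
by elim: p => //= t p IH; rewrite pinsE big_cons IH.
Qed.

Definition psort (p : seq (nat * seq nat)) := [seq (t.1, sort leq t.2) | t <- p].

Lemma peval_collect u k p :
  peval u (pcollect (psort (iter k (pcollect \o Hpol) p))) = peval u (iter k Hpol p).
Proof.
rewrite /peval sum_pcollect big_map /=.
rewrite (eq_bigr (fun t => t.1%:R * mprod u t.2)); last first.
  by move=> t _; congr (_ * _); apply: perm_big; rewrite perm_sort.
elim: k (mprod u) => // k IH f.
by rewrite !iterS /= sum_pcollect !sum_Hpol IH.
Qed.

End cumulant_flow.

(** * Shape of the monomials in the iterates *)

Section monomial_growth.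
Local Open Scope nat_scope.
Implicit Types (a b : seq nat).

Definition weight a := \sum_(i <- a) i.+1.

(* In multigraph terms: each factor [i] is a vertex of degree [i.+1], there
   are [e] edges, and deleting a vertex leaves a connected graph. *)
Definition tight e a := (weight a == e.*2) && all (fun i => i + size a <= e.+1) a.

Lemma weight_cons n a : weight (n :: a) = n.+1 + weight a.
Proof. exact: big_cons. Qed.

Lemma dmonP M a b : all (leq^~ M) a -> b \in dmon a ->
  [/\ weight b = (weight a).+1, size b = size a & all (leq^~ M.+1) b].
Proof.
elim: a b => //= n a IH b /andP[nM aM]; rewrite inE => /predU1P[->|/mapP[c ca ->]].
  rewrite !weight_cons /= ltnS nM; split => //.
  by apply: sub_all aM => i; exact: leqW.
have [wc sc cM] := IH c aM ca.
by rewrite !weight_cons wc /= sc (leqW nM) addnS; split.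
Qed.

Lemma HmonP M a t : all (leq^~ M) a -> t \in Hmon a ->
  weight t.2 = (weight a).+2 /\
  ((size t.2 = size a /\ all (leq^~ M.+1) t.2) \/
   (size t.2 = (size a).+1 /\ all (leq^~ M) t.2)).
Proof.
elim: a t => //= n a IH t /andP[nM aM]; rewrite !mem_cat => /or3P[] /mapP[].
- move=> x xa -> /=; have [w H] := IH x aM xa; rewrite !weight_cons w; split; first by rewrite !addnS.
  by case: H => -[-> ->]; [left|right]; rewrite ?nM ?(leqW nM).
- move=> j; rewrite mem_iota add1n ltnS => /andP[j0 jn] -> /=; split.
    by rewrite !weight_cons; move: jn; clear; lia.
  right; rewrite aM andbT (leq_trans jn nM); split => //=.
  by rewrite (leq_trans _ nM)//; move: j0; clear; lia.
- move=> b ba -> /=; have [wb sb bM] := dmonP _ _ _ aM ba.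
  rewrite !weight_cons wb sb bM ltnS nM; split; first by lia.
  by left.
Qed.

(** Both kinds of move add 2 to the weight, that is, one edge. Raising two factors keeps their
    number and lifts each index by at most one; splitting a factor adds one factor and lifts no
    index. Either way the sum of index and size grows by at most one. *)
Lemma tight_Hmon e a t : tight e a -> t \in Hmon a -> tight e.+1 t.2.
Proof.
case: a => // n a /andP[/eqP we alle] tH.
have sz : size (n :: a) <= e.+1.
  by case/andP: alle => + _; apply: leq_trans; exact: leq_addl.
have aM : all (leq^~ (e.+1 - size (n :: a))) (n :: a).
  by apply: sub_all alle => i; lia.
have [wt H] := HmonP _ _ _ aM tH.
rewrite /tight wt we doubleS eqxx /=.
by case: H => -[-> ]; apply: sub_all => i; lia.
Qed.

Definition flow k : seq (nat * seq nat) := iter k Hpol [:: (1, [:: 1])].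

Lemma mem_Hpol c a d b p : (c, a) \in p -> (d, b) \in Hmon a -> (c * d, b) \in Hpol p.
Proof.
move=> cap dba; apply/flattenP; exists [seq ((c * x.1), x.2) | x <- Hmon a].
  by apply/mapP; exists (c, a).
by apply/mapP; exists (d, b).
Qed.

Lemma tight_flow k t : t \in flow k -> tight k.+1 t.2.
Proof.
elim: k t => [|k IH] t; first by rewrite inE => /eqP ->; rewrite /tight /weight big_seq1.
rewrite /flow iterS => /flattenP[s /mapP[x xk ->]] /mapP[y yx -> /=].
exact: tight_Hmon (IH _ xk) yx.
Qed.

Lemma size_flow k t : t \in flow k.+1 -> 1 < size t.2.
Proof.
have sH M a x : all (leq^~ M) a -> x \in Hmon a -> size a <= size x.2.
  by move=> aM /(HmonP _ _ _ aM)[_ [] [-> _]].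
have allM a : exists M, all (leq^~ M) a.
  elim: a => [|n a [M aM]]; first by exists 0.
  by exists (n + M); rewrite /= leq_addr; apply: sub_all aM => i /leq_trans -> //; exact: leq_addl.
elim: k t => [|k IH] t; first by rewrite !inE => /eqP ->.
rewrite /flow iterS => /flattenP[s /mapP[x xk ->]] /mapP[y yx -> /=].
by have [M aM] := allM x.2; apply: leq_trans (IH _ xk) (sH _ _ _ aM yx).
Qed.

(** The square is carried along by raising both of its factors, each time with coefficient 2. *)
Lemma flow_top k : exists2 c, 0 < c & (c, [:: k.+1; k.+1]) \in flow k.+1.
Proof.
elim: k => [|k [c c0 ck]]; first by exists 2.
exists (c * 2); first by rewrite muln_gt0 c0.
rewrite /flow iterS; apply: mem_Hpol ck _.
by rewrite /= cats0 !(inE, mem_cat) eqxx !orbT.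
Qed.

(** Obtained from the square of u_{k+4} by splitting one factor. For k > 0 the top factor occurs
    only once, and for k odd all three indices are odd, so the monomial is nonzero for X and changes
    sign with its top factor. *)
Lemma flow_split k : exists2 c, 0 < c & (c, [:: k.+4; 3; k.+2]) \in flow k.+4.+1.
Proof.
have [c c0 ck] := flow_top k.+3.
exists (c * 'C(k.+4.+1, 3)); first by rewrite muln_gt0 c0 bin_gt0.
rewrite /flow iterS; apply: mem_Hpol ck _.
rewrite -[Hmon _]/([seq _ | _ <- Hmon [:: k.+4]] ++ _) mem_cat; apply/orP; left; apply/mapP.
exists ('C(k.+4.+1, 3), [:: 3; k.+2]) => //.
by rewrite /= cats0 !inE eqxx !orbT.
Qed.

Lemma tight_size2 e a : tight e.+1 a -> size a = 2 -> a = [:: e; e].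
Proof.
case: a => [|i [|j [|]]] // /andP[]; rewrite /weight !big_cons big_nil /= => /eqP w.
by move=> /and3P[i1 j1 _] _; congr [:: _; _]; lia.
Qed.

Lemma tight_leq n e a j : tight e a -> n <= size a -> j \in a -> j + n <= e.+1.
Proof.
by case/andP=> _ /allP al na /al; apply: leq_trans; rewrite leq_add2l.
Qed.

End monomial_growth.

(** * Recovering the cumulants from the coefficients *)

Section cumulants_from_flow.
Context {K : realFieldType}.
Implicit Types (u v : nat -> K) (a : seq nat).

(** A sum of nonnegative differences with nonnegative coefficients vanishes only if every difference
    with positive coefficient does. *)
Lemma peval_le_eq u v p : peval u p = peval v p ->
  (forall t, t \in p -> mprod u t.2 <= mprod v t.2) ->
  forall c a, (0 < c)%N -> (c, a) \in p -> mprod u a = mprod v a.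
Proof.
move=> E le c a c0 cap.
have : \sum_(t <- p | t \in p) t.1%:R * (mprod v t.2 - mprod u t.2) = 0.
  rewrite -big_seq; under eq_bigr do rewrite mulrBr.
  by rewrite sumrB -/(peval v p) -E subrr.
move/eqP; rewrite psumr_eq0; last first.
  by move=> t tp; rewrite mulr_ge0 ?ler0n// subr_ge0 le.
move/allP => /(_ _ cap) /implyP /(_ cap) /=.
rewrite mulf_eq0 pnatr_eq0 subr_eq0 => /orP[/eqP c00|/eqP ->//].
by rewrite c00 in c0.
Qed.

Lemma eq_mprod u v a : {in a, u =1 v} -> mprod u a = mprod v a.
Proof. by move=> uv; rewrite /mprod; apply: eq_big_seq. Qed.

Lemma mprod2 u i j : mprod u [:: i; j] = u i * u j.
Proof. by rewrite /mprod !big_cons big_nil mulr1. Qed.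

Lemma mprod3 u i j k : mprod u [:: i; j; k] = u i * (u j * u k).
Proof. by rewrite mprod_cons mprod2. Qed.

Lemma sqr_of_flow u v i : (forall j, (j < i.+1)%N -> u j = v j) ->
  peval u (flow i.+1) = peval v (flow i.+1) -> u i.+1 ^+ 2 = v i.+1 ^+ 2.
Proof.
move=> uv E.
(* The termwise comparison is one-sided, while the hypotheses are symmetric in u and v. *)
wlog le : u v uv E / u i.+1 ^+ 2 <= v i.+1 ^+ 2.
  move=> H; have [/H->//|/ltW le] := lerP (u i.+1 ^+ 2) (v i.+1 ^+ 2).
  by apply/esym/H => // j /uv.
have [c c0 ci] := flow_top i.
rewrite !expr2 -!mprod2; apply: peval_le_eq E _ _ _ c0 ci => t tp.
have tt := tight_flow _ _ tp; have st := size_flow _ _ tp.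
move: st; rewrite leq_eqVlt => /predU1P[/esym s2|s3].
  by rewrite (tight_size2 _ _ tt s2) !mprod2 -!expr2.
rewrite (eq_mprod u v) // => j jt; apply: uv.
by have := tight_leq _ _ _ _ tt s3 jt; rewrite addn3 !ltnS.
Qed.

(** With two factors, a square is compared with u_{i+2}^2 = 0. With three, u being nonpositive makes
    the product minus its absolute value, the least value reachable by changing signs. With four or
    more, the index i + 1 cannot occur. *)
Lemma mprod_flip_le u v i t :
  (forall j, (j < i.+1)%N -> u j = v j) -> v i.+1 = - u i.+1 ->
  (forall j, u j <= 0) -> u i.+2 = 0 ->
  t \in flow i.+2 -> mprod u t.2 <= mprod v t.2.
Proof.
move=> uv vi u0 ui2 tp.
have tt := tight_flow _ _ tp; have st := size_flow _ _ tp.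
case: t {tp} tt st => _ /= a.
case: a => [|x [|y [|z [|w a]]]] //=.
- move=> tt _; rewrite (tight_size2 _ _ tt) // !mprod2 ui2 mul0r; exact: sqr_ge0.
- move=> /andP[_ /and4P[xi yi zi _]] _; rewrite !mprod3.
  have vE j : (j + 3 <= i.+4)%N -> exists2 b : bool, v j = (-1) ^+ b * u j & `|v j| = - u j.
    rewrite addn3 !ltnS leq_eqVlt => /predU1P[->|ji].
      by exists true; rewrite ?expr1 ?mulN1r // vi normrN ler0_norm.
    by exists false; rewrite -?uv ?expr0 ?mul1r // ler0_norm.
  have [_ _ nx] := vE x xi; have [_ _ ny] := vE y yi; have [_ _ nz] := vE z zi.
  rewrite -[u x * _]opprK lerNl.
  have -> : - (u x * (u y * u z)) = `|v x * (v y * v z)|.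
    by rewrite !normrM nx ny nz; ring.
  by rewrite -normrN ler_norm.
- move=> tt _; rewrite (eq_mprod u v) // => j jt; apply: uv.
  by have := tight_leq 4 _ _ _ tt isT jt; rewrite addn4 !ltnS.
Qed.

(** The factor 32 is 2^5: in each application of H raisings carry a 2, and splittings pair up by
    symmetry of the binomials, the middle one being even. *)
Lemma flow5 u : u 2%N = 0 -> u 4%N = 0 -> peval u (flow 5) =
  32%:R * (u 5%N ^+ 2 + 30%:R * u 3%N ^+ 3 + 300%:R * u 1%N ^+ 2 * u 3%N ^+ 2 + 120%:R * u 1%N ^+ 6).
Proof.
move=> u2 u4; rewrite /flow -peval_collect.
have -> : pcollect (psort (iter 5 (pcollect \o Hpol) [:: (1, [:: 1])]))%N =
  [seq (32 * t.1, t.2)%N | t <- [:: (1, [:: 5; 5]); (30, [:: 1; 4; 4]); (120, [:: 2; 3; 4]);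
           (30, [:: 3; 3; 3]); (300, [:: 1; 1; 3; 3]);
           (900, [:: 1; 2; 2; 3]); (210, [:: 2; 2; 2; 2]);
           (1200, [:: 1; 1; 1; 2; 2]); (120, [:: 1; 1; 1; 1; 1; 1])]]%N.
  by apply/eqP; vm_compute.
rewrite /peval big_map; under eq_bigr do rewrite natrM -mulrA.
rewrite -mulr_sumr; congr (_ * _).
rewrite !big_cons big_nil /mprod !big_cons !big_nil u2 u4 !(mulr0,mul0r,mulr1,add0r,addr0) /=; ring.
Qed.

(** The coefficients of u_1^7 and u_1^3 u_3^2 stay anonymous: these terms do not feel the sign of
    u_3 and cancel in the comparison. The product 42 * 30 displays the factor shared with u_1
    u_5^2. *)
Lemma flow6 : exists c1 c2 : K, forall u, u 2%N = 0 -> u 4%N = 0 -> peval u (flow 6) =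
  64%:R * (c1 * u 1%N ^+ 7 + c2 * u 1%N ^+ 3 * u 3%N ^+ 2 + 42%:R * 30%:R * u 1%N * u 3%N ^+ 3
     + 140%:R * u 3%N ^+ 2 * u 5%N + 42%:R * u 1%N * u 5%N ^+ 2 + u 6%N ^+ 2).
Proof.
pose q (c1 c2 c3 c4 c5 c6 c7 c8 : nat) := [:: (c1, [:: 1; 1; 1; 1; 1; 1; 1]);
  (c3, [:: 1; 1; 1; 1; 2; 2]); (c4, [:: 1; 1; 2; 2; 3]); (c2, [:: 1; 1; 1; 3; 3]);
  (c5, [:: 1; 2; 2; 2; 2]); (42 * 30, [:: 1; 3; 3; 3]); (c6, [:: 1; 2; 3; 4]);
  (c7, [:: 2; 2; 3; 3]); (c8, [:: 2; 2; 2; 4]); (140, [:: 3; 3; 5]);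
  (210, [:: 3; 4; 4]); (630, [:: 1; 1; 4; 4]); (210, [:: 2; 4; 5]); (42, [:: 1; 5; 5]);
  (1, [:: 6; 6])]%N.
have qE u c1 c2 c3 c4 c5 c6 c7 c8 : u 2%N = 0 -> u 4%N = 0 ->
    peval u [seq (64 * t.1, t.2)%N | t <- q c1 c2 c3 c4 c5 c6 c7 c8] =
    64%:R * (c1%:R * u 1%N ^+ 7 + c2%:R * u 1%N ^+ 3 * u 3%N ^+ 2 +
      42%:R * 30%:R * u 1%N * u 3%N ^+ 3 + 140%:R * u 3%N ^+ 2 * u 5%N
      + 42%:R * u 1%N * u 5%N ^+ 2 + u 6%N ^+ 2).
  move=> u2 u4; rewrite /peval big_map; under eq_bigr do rewrite natrM -mulrA.
  rewrite -mulr_sumr; congr (_ * _).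
  rewrite !big_cons big_nil /mprod !big_cons !big_nil u2 u4.
  by rewrite !(mulr0,mul0r,mulr1,add0r,addr0) /= natrM; ring.
exists (72 * 10)%N%:R, (42 * 100)%N%:R => u u2 u4.
rewrite /flow -peval_collect.
have : pcollect (psort (iter 6 (pcollect \o Hpol) [:: (1, [:: 1])]))%N ==
    [seq (64 * t.1, t.2)%N | t <- q (72 * 10)%N (42 * 100)%N
    (126 * 100)%N (189 * 100)%N (882 * 10)%N (504 * 10)%N (483 * 10)%N (126 * 10)%N].
  by vm_compute.
move/eqP=> ->; exact: qE.
Qed.
(* The sign of the fourth cumulant is invisible until the sixth derivative. *)
Lemma no_flip3 u v : (forall k, peval u (flow k) = peval v (flow k)) ->
  (forall j, (j < 3)%N -> u j = v j) -> v 3%N = - u 3%N ->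
  (forall j, u j <= 0) -> u 2%N = 0 -> u 4%N = 0 -> u 6%N = 0 ->
  u 3%N < 0 -> u 5%N < 0 -> False.
Proof.
move=> E uv v3 u0 u2 u4 u6 u3 u5.
(* With three factors the indices here sum to 7 and are at most 3, so u_3 has odd exponent only in
   u_3 u_2^2, which vanishes. No strict inequality arises; the square yields v_4 = 0, needed to
   evaluate the next two coefficients at v. *)
have v4 : v 4%N = 0.
  have [c c0 ci] := flow_top 3.
  have := peval_le_eq _ _ _ (E 4%N) (fun t => mprod_flip_le u v 2 t uv v3 u0 u4) _ _ c0 ci.
  by rewrite !mprod2 u4 mul0r => /esym/eqP; rewrite mulf_eq0 orbb => /eqP.
have v2 : v 2%N = 0 by rewrite -uv.
have v1 : v 1%N = u 1%N by rewrite -uv.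
have := E 5%N; rewrite !flow5 // => /(mulfI _) -/(_ _).
have [c1 [c2 H6]] := flow6; have := E 6%N; rewrite !H6 // => /(mulfI _) -/(_ _).
rewrite !pnatr_eq0 u6 v1 v3 => /(_ isT) e6 /(_ isT) e5.
have h5 : v 5%N ^+ 2 = u 5%N ^+ 2 + 60%:R * u 3%N ^+ 3.
  rewrite sqrrN in e5.
  have -> : v 5%N ^+ 2 = (u 5%N ^+ 2 + 30%:R * u 3%N ^+ 3 + 300%:R * u 1%N ^+ 2 * u 3%N ^+ 2
    + 120%:R * u 1%N ^+ 6) - (30%:R * (- u 3%N) ^+ 3 + 300%:R * u 1%N ^+ 2 * u 3%N ^+ 2
    + 120%:R * u 1%N ^+ 6) by rewrite e5; move: (120%:R) (300%:R) => c d; ring.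
  by move: (120%:R) (300%:R) => c d; ring.
(* By [h5] the terms in u_1 u_3^3 and u_1 u_5^2 cancel, as 2 * 42 * 30 = 42 * 60. Nonnegativity of
   v_6^2 then forces v_5 <= u_5 < 0, so v_5^2 >= u_5^2, against [h5] with u_3 < 0. *)
have h6 : v 6%N ^+ 2 = 140%:R * u 3%N ^+ 2 * (u 5%N - v 5%N).
  rewrite sqrrN in e6; move: (140%:R) e6 => d e6.
  have -> : v 6%N ^+ 2 = (c1 * u 1%N ^+ 7 + c2 * u 1%N ^+ 3 * u 3%N ^+ 2 + 42%:R * 30%:R * u 1%N * u 3%N ^+ 3
     + d * u 3%N ^+ 2 * u 5%N + 42%:R * u 1%N * u 5%N ^+ 2 + 0 ^+ 2) - (c1 * u 1%N ^+ 7 + c2 * u 1%N ^+ 3 * u 3%N ^+ 2 + 42%:R * 30%:R * u 1%N * (- u 3%N) ^+ 3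
     + d * u 3%N ^+ 2 * v 5%N + 42%:R * u 1%N * v 5%N ^+ 2) by rewrite e6; ring.
  by rewrite h5; ring.
have u33 : u 3%N ^+ 3 < 0 by rewrite exprS nmulr_rlt0 // exprn_even_gt0 //= lt_eqF.
have u32 : 0 < u 3%N ^+ 2 by rewrite exprn_even_gt0 //= lt_eqF.
have v5 : v 5%N <= u 5%N.
  have : 0 <= 140%:R * u 3%N ^+ 2 * (u 5%N - v 5%N) by rewrite -h6 sqr_ge0.
  by rewrite pmulr_rge0 ?subr_ge0 // mulr_gt0.
have : u 5%N ^+ 2 <= v 5%N ^+ 2 by nra.
by rewrite h5; lra.
Qed.

Theorem ncum_eq_of_flow u v : (forall k, peval u (flow k) = peval v (flow k)) ->
  u 0%N = v 0%N -> (forall i, ~~ odd i -> u i = 0) -> (forall i, odd i -> u i < 0) -> u =1 v.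
Proof.
move=> E uv0 ue uo.
have u0 j : u j <= 0 by have [/uo/ltW//|/ue->] := boolP (odd j).
move=> n; have [k] := ubnP n; elim: k n => // k IH [//|i]; rewrite ltnS => ik.
have uv j : (j < i.+1)%N -> u j = v j by move=> ji; apply: IH; apply: leq_trans ji ik.
have := sqr_of_flow _ _ _ uv (E i.+1); have [oi|ei] := boolP (odd i.+1); last first.
  by rewrite (ue _ ei) expr0n /= => /esym/eqP; rewrite sqrf_eq0 => /eqP ->.
move=> /eqP; rewrite eqf_sqr => /orP[/eqP//|/eqP ui].
have vi : v i.+1 = - u i.+1 by rewrite ui opprK.
have ui2 : u i.+2 = 0 by apply: ue; rewrite /= negbK; exact: oi.
(* The index is i + 1: for 1 the zeroth coefficient is u_1 itself, 2 and 4 are excluded by parity, 3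
   is [no_flip3], and from 5 on the monomial of [flow_split] decides the sign. *)
case: i => [|[|[|[|i]]]] in ik uv oi ui vi ui2 * => //.
- have := E 0%N; rewrite /flow /peval !big_seq1 /= !mul1r /mprod !big_seq1 //.
- by have := no_flip3 u v E uv vi u0 (ue 2%N isT) (ue 4%N isT) (ue 6%N isT) (uo 3%N isT) (uo 5%N isT).
have [c c0 ci] := flow_split i.+1.
have := peval_le_eq _ _ _ (E _) (fun t => mprod_flip_le u v _ t uv vi u0 ui2) _ _ c0 ci.
rewrite !mprod3 vi -(uv 3%N isT) -(uv i.+3) //.
have : u i.+4.+1 * (u 3%N * u i.+3) < 0.
  rewrite nmulr_rlt0 ?uo // nmulr_rgt0 ?uo //.
  by move: oi; rewrite /= !negbK.
lra.
Qed.

End cumulants_from_flow.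

(** * Derivatives of posterior cumulants along a flow *)

Section is_derive_cumulants.
Context {R : realType}.
Implicit Types (t a b : R).

(** By [ncum_flow] the expected derivative v solves the differentiated recursion. Since m_0 = 1 and
    the derivative of m_0 is 0, this recursion gives v_n from the earlier terms, and strong
    induction applies. *)
Lemma is_derive_ncum (m : R -> nat -> R) t a b (u := ncum (m t)) :
  m t 0%N = 1 ->
  (forall n, is_derive t 1 (fun s => m s n)
     (a * (m t n.+1 - m t 1%N * m t n) + b * (m t n.+2 - m t 2%N * m t n))) ->
  forall n, is_derive t 1 (fun s => ncum (m s) n)
    (a * u n.+1 + b * (u n.+2 - bconv u u n.+1)).
Proof.
move=> m0 dm n; have [k] := ubnP n; elim: k n => // k IH n; rewrite ltnS => nk.
pose v := fun n => a * u n.+1 + b * (u n.+2 - bconv u u n.+1).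
pose dmt := fun n => a * (m t n.+1 - m t 1%N * m t n) + b * (m t n.+2 - m t 2%N * m t n).
have -> : (fun s => ncum (m s) n) = (fun s => - m s n.+1) -
    \sum_(j < n) (fun s => 'C(n, j)%:R * ncum (m s) j * m s (n - j)%N).
  by apply/funext => s; rewrite ncumE !fctE fct_sumE.
have du (j : 'I_n) : is_derive t 1 (fun s => ncum (m s) j) (v j).
  by apply: IH; exact: leq_trans (ltn_ord j) nk.
have dj (j : 'I_n) : is_derive t 1 (fun s => 'C(n, j)%:R * ncum (m s) j * m s (n - j)%N)
    ('C(n, j)%:R * v j * m t (n - j)%N + 'C(n, j)%:R * u j * dmt (n - j)%N).
  have := du j; have := dm (n - j)%N => d1 d2.
  apply: is_derive_eq; rewrite /dmt /u /GRing.scale /=; ring.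
apply: is_derive_eq.
have E : dmt n.+1 = - (bconv v (m t) n + bconv u dmt n) by exact: ncum_flow _ a b m0 n.
have dmt0 : dmt 0%N = 0 by rewrite /dmt m0 !mulr1 !subrr !mulr0 addr0.
rewrite !bconv_recl dmt0 m0 mulr1 mulr0 add0r in E.
by rewrite -/(v n) -/(dmt n.+1) E big_split /=; ring.
Qed.

Definition posterior (Z : nat -> R) (n : nat) : R := Z n / Z 0%N.

Definition wprod (Z : nat -> R) (l : seq nat) : R := Z 0%N * mprod (ncum (posterior Z)) l.

Lemma is_derive_mprod (u : R -> nat -> R) (v : nat -> R) t l :
  (forall n, is_derive t 1 (fun s => u s n) (v n)) ->
  is_derive t 1 (fun s => mprod (u s) l) (mderiv v (u t) l).
Proof.
move=> du; elim: l => [|n l IH].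
  rewrite [X in is_derive _ _ X](_ : _ = cst 1); last by apply/funext => s; rewrite /mprod big_nil.
  exact: is_derive_cst.
rewrite [X in is_derive _ _ X](_ : _ = (fun s => u s n) * (fun s => mprod (u s) l)); last first.
  by apply/funext => s; rewrite mprod_cons.
have := du n => dn; apply: is_derive_eq; rewrite /GRing.scale /=; ring.
Qed.

Lemma mderiv_linear (K : comNzRingType) (a b : K) (v w u : nat -> K) l :
  mderiv (fun n => a * v n + b * w n) u l = a * mderiv v u l + b * mderiv w u l.
Proof. by elim: l => [|n l IH] /=; rewrite ?mulr0 ?addr0// IH; ring. Qed.

Lemma is_derive_posterior (Z : R -> nat -> R) t a b (m := fun s => posterior (Z s)) :
  Z t 0%N != 0 ->
  (forall n, is_derive t 1 (fun s => Z s n) (a * Z t n.+1 + b * Z t n.+2)) ->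
  forall n, is_derive t 1 (fun s => m s n)
    (a * (m t n.+1 - m t 1%N * m t n) + b * (m t n.+2 - m t 2%N * m t n)).
Proof.
move=> Z0 dZ n.
have -> : (fun s => m s n) = (fun s => Z s n) * (fun s => (Z s 0%N)^-1) by [].
have := dZ n; have := dZ 0%N => d0 dn.
have dV := is_deriveV Z0 d0.
apply: is_derive_eq; rewrite /GRing.scale /= /m /posterior; field; exact: Z0.
Qed.

(** In the channel, a and b are the coefficients of x and x^2 in the logarithmic derivative of the
    likelihood. The first part acts by A, the second by A^2 - H. *)
Lemma is_derive_wprod (Z : R -> nat -> R) t a b l :
  Z t 0%N != 0 ->
  (forall n, is_derive t 1 (fun s => Z s n) (a * Z t n.+1 + b * Z t n.+2)) ->
  is_derive t 1 (fun s => wprod (Z s) l)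
    (a * Amap (wprod (Z t)) l + b * (Amap (Amap (wprod (Z t))) l - Hmap (wprod (Z t)) l)).
Proof.
move=> Z0 dZ.
pose m s := posterior (Z s); pose u := ncum (m t).
have m0 : m t 0%N = 1 by rewrite /m /posterior divff.
have dm := is_derive_posterior Z t a b Z0 dZ.
have du := is_derive_ncum _ _ _ _ m0 dm.
have dp := is_derive_mprod _ _ _ l du.
have d0 := dZ 0%N.
have -> : (fun s => wprod (Z s) l) = (fun s => Z s 0%N) * (fun s => mprod (ncum (m s)) l) by [].
apply: is_derive_eq; rewrite /GRing.scale /=.
have AZ f x : Amap (fun y => Z t 0%N * f y) x = Z t 0%N * Amap f x.
  by rewrite /Amap -mulr_sumr mulrBr.
have HZ f x : Hmap (fun y => Z t 0%N * f y) x = Z t 0%N * Hmap f x.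
  by rewrite /Hmap mulr_sumr; apply: eq_bigr => y _; rewrite mulrCA.
have wE : wprod (Z t) = fun y => Z t 0%N * mprod u y by [].
have AE : Amap (wprod (Z t)) = fun y => Z t 0%N * Amap (mprod u) y.
  by apply/funext => y; rewrite wE AZ.
rewrite AE AZ wE HZ -mulrBr Amap2_mprod Amap_mprod.
rewrite (mderiv_linear _ a b (bshift u) (fun n => u n.+2 - bconv u u n.+1)).
have u0 : u 0%N = - m t 1%N by rewrite /u ncumE big_ord0 subr0.
have u1 : u 1%N = - m t 2%N - u 0%N * m t 1%N.
  by rewrite /u ncumE big_ord1 /= bin0 mul1r subn0.
have Z1 : Z t 1%N = - Z t 0%N * u 0%N by rewrite u0 /m /posterior; field.
have Z2 : Z t 2%N = Z t 0%N * (u 0%N ^+ 2 - u 1%N) by rewrite u1 u0 /m /posterior; field.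
rewrite Z1 Z2; move: (mderiv _ _ _) (mderiv _ _ _) => p q; ring.
Qed.

End is_derive_cumulants.

(** * The standard Gaussian measure and its translations *)

Section gauss_probability.
Context {R : realType}.
Local Notation gamma := (@gauss R).

(** [gauss] is a bare set function in the definitions; the measure and probability structures are
    transferred from [normal_prob]. *)
Let gauss0 : gamma set0 = 0%E.
Proof. exact: (measure0 (@normal_prob R 0 1)). Qed.

Let gauss_ge0 A : (0 <= gamma A)%E.
Proof. exact: (measure_ge0 (@normal_prob R 0 1)). Qed.

Let gauss_sigma_additive : semi_sigma_additive gamma.
Proof. exact: (@measure_semi_sigma_additive _ _ _ (@normal_prob R 0 1)). Qed.

HB.instance Definition _ := isMeasure.Build _ R R gamma gauss0 gauss_ge0 gauss_sigma_additive.

Let gauss_setT : gamma setT = 1%E.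
Proof. exact: (@probability_setT _ _ _ (@normal_prob R 0 1)). Qed.

HB.instance Definition _ := @Measure_isProbability.Build _ R R gamma gauss_setT.

End gauss_probability.

Section standard_gaussian.
Context {R : realType}.
Local Notation gamma := (@gauss R).
Local Notation leb := (@lebesgue_measure R).

Lemma ge0_integral_gauss (f : R -> \bar R) : measurable_fun setT f ->
  (forall x, (0 <= f x)%E) ->
  (\int[gamma]_x f x = \int[leb]_x (f x * (normal_pdf 0 1 x)%:E))%E.
Proof.
move=> mf f0.
have mid : measurable_fun [set: measurableTypeR R] (id : measurableTypeR R -> R) by [].
transitivity (\int[@normal_prob R 0 1]_x f x)%E.
  exact: (ge0_integral_pushforward mid (@normal_prob R 0 1) measurableT mf (fun x _ => f0 x)).
have dom := @normal_prob_dominates R 0 1.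
pose g := Radon_Nikodym_SigmaFinite.f (@normal_prob R 0 1) leb.
have ig : leb.-integrable setT g by exact: Radon_Nikodym_SigmaFinite.f_integrable.
rewrite -(Radon_Nikodym_SigmaFinite.change_of_variables dom f0 measurableT mf).
apply: ae_eq_integral => //.
- apply: emeasurable_funM => //; exact: measurable_int ig.
- by apply: emeasurable_funM => //; apply/measurable_EFinP; exact: measurable_normal_pdf.
(* The Radon-Nikodym derivative and [normal_pdf] have the same integral over every measurable set,
   hence agree almost everywhere. *)
- apply: ae_eqe_mul2l; apply: integral_ae_eq => //.
    by apply/measurable_EFinP; exact: measurable_normal_pdf.
  by move=> E _ mE; rewrite -Radon_Nikodym_SigmaFinite.f_integral.
Qed.

Lemma ge0_integral_lebesgue_translation (t : R) (f : R -> \bar R) : measurable_fun setT f ->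
  (forall x, (0 <= f x)%E) -> (\int[leb]_x f (x + t)%R = \int[leb]_x f x)%E.
Proof.
move=> mf f0.
pose phi (x : R) : R := x + t.
have mphi : measurable_fun [set: measurableTypeR R] (phi : measurableTypeR R -> measurableTypeR R).
  exact: measurable_funD.
pose m : {measure set (measurableTypeR R) -> \bar R} :=
  measure_function_pushforward__canonical__measure_function_Measure leb mphi.
have mE (A : set R) : measurable A -> leb A = m A.
  apply: lebesgue_measure_unique => X [[a b] _ <-].
  rewrite /m /= /pushforward /=.
  have -> : phi @^-1` `]a, b]%classic = `]a - t, b - t]%classic.
    by apply/seteqP; split => x /=; rewrite !in_itv /= /phi ltrBlDr lerBrDr.
  rewrite !lebesgue_measure_itv /= !lte_fin ltrD2r -!EFinD.
  by congr (if _ then _%:E else _); ring.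
transitivity (\int[m]_x f x)%E.
  rewrite /m /= ge0_integral_pushforward //=.
apply: eq_measure_integral => A mA _; exact/esym/mE.
Qed.

Lemma normal_pdf01 x : normal_pdf 0 1 x = normal_peak 1 * expR (- (x ^+ 2 / 2)) :> R.
Proof.
rewrite normal_pdfE ?oner_neq0 // /normal_fun subr0 expr1n; congr (_ * expR _); ring.
Qed.

(** The Cameron-Martin formula on the line: translating the density and completing the square
    produces the exponential, which is the likelihood [lik] once t = r x. *)
Lemma gauss_shift (t : R) (f : R -> \bar R) : measurable_fun setT f ->
  (forall x, (0 <= f x)%E) ->
  (\int[gamma]_x f (x + t)%R = \int[gamma]_x (f x * (expR (t * x - t ^+ 2 / 2))%:E))%E.
Proof.
move=> mf f0.
have mt : measurable_fun setT (fun x : R => x + t) by exact: measurable_funD.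
rewrite !ge0_integral_gauss //; first last.
- exact: (measurableT_comp mf).
- by move=> x; rewrite mule_ge0 // lee_fin expR_ge0.
- apply: emeasurable_funM => //; apply/measurable_EFinP.
  apply: measurableT_comp => //; apply: measurable_funB => //; exact: measurable_funM.
rewrite -[RHS](ge0_integral_lebesgue_translation t); first last.
- by move=> x; rewrite !mule_ge0 // lee_fin ?expR_ge0 // normal_pdf_ge0.
- apply: emeasurable_funM; last by apply/measurable_EFinP; exact: measurable_normal_pdf.
  apply: emeasurable_funM => //; apply/measurable_EFinP.
  apply: measurableT_comp => //; apply: measurable_funB => //; exact: measurable_funM.
apply: eq_integral => x _; rewrite -muleA; congr (_ * _)%E.
rewrite -EFinM; congr (_%:E); rewrite !normal_pdf01 mulrCA; congr (_ * _).
by rewrite -expRD; congr expR; field.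
Qed.

End standard_gaussian.

(** * Integrability of real-valued functions *)

Lemma dominated_integrable (R : realType) (d : measure_display) (T : measurableType d)
    (mu : {measure set T -> \bar R}) (f g : T -> R) :
  measurable_fun setT f -> (forall x, `|f x| <= g x) ->
  mu.-integrable setT (EFin \o g) -> mu.-integrable setT (EFin \o f).
Proof.
move=> mf fg; apply: le_integrable => //; first exact/measurable_EFinP.
by move=> x _ /=; rewrite lee_fin (le_trans (fg x)) // ler_norm.
Qed.

Section real_integrable.
Context {R : realType} {d : measure_display} {T : measurableType d}.
Variable mu : {measure set T -> \bar R}.
Implicit Types f g : T -> R.

Lemma integrable_scale (k : R) f : mu.-integrable setT (EFin \o f) ->
  mu.-integrable setT (EFin \o (fun x => k * f x)).
Proof. by move=> fi; have := integrableZl measurableT k fi; apply: eq_integrable. Qed.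

Lemma integrable_add f g : mu.-integrable setT (EFin \o f) -> mu.-integrable setT (EFin \o g) ->
  mu.-integrable setT (EFin \o (fun x => f x + g x)).
Proof. by move=> fi gi; have := integrableD measurableT fi gi; apply: eq_integrable. Qed.

Lemma integrable_sub f g : mu.-integrable setT (EFin \o f) -> mu.-integrable setT (EFin \o g) ->
  mu.-integrable setT (EFin \o (fun x => f x - g x)).
Proof. by move=> fi gi; have := integrableB measurableT fi gi; apply: eq_integrable. Qed.

Lemma Rintegral_prob_cst (P : probability T R) (c : R) : (\int[P]_x c)%R = c.
Proof.
rewrite Rintegral_cst // -[RHS]mulr1; congr (_ * _).
by rewrite -[RHS]/(fine 1%E); congr fine; exact: probability_setT.
Qed.

End real_integrable.

(** * Bounding cumulant monomials by moments *)

Section cumulant_bounds.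
Context {R : realType}.
Implicit Types (m b : nat -> R).

(** The recursion is homogeneous, [ncum m n] having degree n + 1 when m_i has degree i, and
    [b i * b j <= b (i + j)] merges each product into one value of b. The constant precedes m and b
    because both will vary with the observation. *)
Lemma ncum_bound n : exists2 C : R, 0 <= C & forall m b,
  (forall i, `|m i| <= b i) -> (forall i j, b i * b j <= b (i + j)%N) ->
  `|ncum m n| <= C * b n.+1.
Proof.
have [k] := ubnP n; elim: k n => // k IH n; rewrite ltnS => nk.
have IH' (j : 'I_n) : {C : R | 0 <= C & forall m b,
  (forall i, `|m i| <= b i) -> (forall i j, b i * b j <= b (i + j)%N) ->
  `|ncum m j| <= C * b j.+1}.
  by apply/cid2/IH; exact: leq_trans nk.
pose C j := s2val (IH' j).
have C0 j : 0 <= C j by exact: (s2valP (IH' j)).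
exists (1 + \sum_(j < n) 'C(n, j)%:R * C j).
  by rewrite addr_ge0 // sumr_ge0 // => j _; rewrite mulr_ge0.
move=> m b mb bb.
rewrite ncumE (le_trans (ler_normB _ _)) // mulrDl mul1r normrN lerD //.
rewrite (le_trans (ler_norm_sum _ _ _)) // mulr_suml ler_sum // => j _.
rewrite !normrM ger0_norm // -!mulrA ler_wpM2l //.
have := s2valP' (IH' j) m b mb bb; rewrite -/(C j) => uj.
rewrite (le_trans (ler_pM _ _ uj (mb _))) // -mulrA ler_wpM2l //.
by rewrite (le_trans (bb _ _)) // addSn subnKC // ltnW.
Qed.

Lemma mprod_ncum_bound l : exists2 C : R, 0 <= C & forall m b, m 0%N = 1 ->
  (forall i, `|m i| <= b i) -> (forall i j, b i * b j <= b (i + j)%N) ->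
  `|mprod (ncum m) l| <= C * b (weight l).
Proof.
elim: l => [|n l [C C0 IH]].
  exists 1 => // m b m0 mb _; rewrite /mprod /weight !big_nil mul1r.
  by rewrite (le_trans _ (mb 0%N)) // m0.
have [D D0 HD] := ncum_bound n.
exists (D * C); first exact: mulr_ge0.
move=> m b m0 mb bb; rewrite mprod_cons weight_cons normrM.
rewrite (le_trans (ler_pM _ _ (HD m b mb bb) (IH m b m0 mb bb))) //.
by rewrite mulrACA ler_wpM2l // mulr_ge0.
Qed.

Definition mprod_const l : R := s2val (cid2 (mprod_ncum_bound l)).

Lemma mprod_const_ge0 l : 0 <= mprod_const l.
Proof. exact: (s2valP (cid2 (mprod_ncum_bound l))). Qed.

Lemma mprod_ncum_le l m b : m 0%N = 1 ->
  (forall i, `|m i| <= b i) -> (forall i j, b i * b j <= b (i + j)%N) ->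
  `|mprod (ncum m) l| <= mprod_const l * b (weight l).
Proof. exact: (s2valP' (cid2 (mprod_ncum_bound l))). Qed.

Lemma measurable_ncum (d : measure_display) (T : measurableType d) (m : T -> nat -> R) :
  (forall n, measurable_fun setT (m ^~ n)) ->
  forall n, measurable_fun setT (fun x => ncum (m x) n).
Proof.
move=> mm n; have [k] := ubnP n; elim: k n => // k IH n; rewrite ltnS => nk.
under eq_fun do rewrite ncumE.
apply: measurable_funB; first exact: measurable_funN.
apply: measurable_sum => j; apply: measurable_funM => //.
by apply: measurable_funM => //; apply: IH; exact: leq_trans nk.
Qed.

Lemma measurable_mprod (d : measure_display) (T : measurableType d) (u : T -> nat -> R) l :
  (forall n, measurable_fun setT (u ^~ n)) ->
  measurable_fun setT (fun x => mprod (u x) l).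
Proof. by move=> mu; apply: measurable_prod. Qed.

End cumulant_bounds.

(** * Unnormalised posterior moments *)

Section posterior_moments.
Context {R : realType} {d : measure_display} {T : measurableType d}.
Variables (P : probability T R) (f : T -> R).
Hypothesis mf : measurable_fun setT f.
Hypothesis fi : forall n, P.-integrable setT (EFin \o (fun x => f x ^+ n)).

(* Likelihood ratio of [r x + N] at [w] with respect to the standard Gaussian. *)
Definition lik (r w x : R) : R := expR (r * w * x - (r * x) ^+ 2 / 2).

Lemma lik_gt0 r w x : 0 < lik r w x. Proof. exact: expR_gt0. Qed.

(** Completing the square. Uniformity in x means that the moments of the signal alone make all
    weighted moments finite at a fixed observation w. *)
Lemma lik_le r w x : lik r w x <= expR (w ^+ 2 / 2).
Proof.
rewrite ler_expR -subr_ge0.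
have -> : w ^+ 2 / 2 - (r * w * x - (r * x) ^+ 2 / 2) = (w - r * x) ^+ 2 / 2 by field.
by rewrite divr_ge0 // sqr_ge0.
Qed.

Lemma measurable_lik d' (T' : measurableType d') r (g h : T' -> R) :
  measurable_fun setT g -> measurable_fun setT h ->
  measurable_fun setT (fun z => lik r (g z) (h z)).
Proof.
move=> mg mh; apply: measurableT_comp => //; apply: measurable_funB.
  by apply: measurable_funM => //; exact: measurable_funM.
by apply: measurable_funM => //; apply: measurable_funX; exact: measurable_funM.
Qed.

(** Posterior moments before normalisation, when w is observed; [tmom r w 0] is the density of the
    observation relative to the standard Gaussian. *)
Definition tmom (r w : R) (n : nat) : R := (\int[P]_x (f x ^+ n * lik r w (f x)))%R.
Definition amom (r w : R) (n : nat) : R := (\int[P]_x (`|f x| ^+ n * lik r w (f x)))%R.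

Lemma integrable_tmom r w n : P.-integrable setT (EFin \o (fun x => f x ^+ n * lik r w (f x))).
Proof.
apply: (dominated_integrable _ _ _ _ _ (fun x => expR (w ^+ 2 / 2) * `|f x ^+ n|)).
- by apply: measurable_funM; [exact: measurable_funX|exact: measurable_lik].
- move=> x; rewrite normrM mulrC ler_wpM2r // ger0_norm ?lik_le //; exact/ltW/lik_gt0.
- by apply: integrable_scale; exact: (integrable_norm (fi n)).
Qed.

Lemma integrable_amom r w n : P.-integrable setT (EFin \o (fun x => `|f x| ^+ n * lik r w (f x))).
Proof.
have := integrable_norm (integrable_tmom r w n); apply: eq_integrable => // x _ /=.
by rewrite normrM normrX (ger0_norm (ltW (lik_gt0 _ _ _))).
Qed.

Lemma amom_ge0 r w n : 0 <= amom r w n.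
Proof. by apply: Rintegral_ge0 => x _; rewrite mulr_ge0 ?exprn_ge0 // ltW // lik_gt0. Qed.

Lemma amom0 r w : amom r w 0%N = tmom r w 0%N.
Proof. by apply: eq_Rintegral => x _; rewrite !expr0. Qed.

Lemma tmom0_gt0 r w : 0 < tmom r w 0%N.
Proof.
rewrite lt0r; apply/andP; split; last by rewrite -amom0 amom_ge0.
apply/eqP => Z0.
have : (\int[P]_x `|(f x ^+ 0 * lik r w (f x))%:E| = 0)%E.
  rewrite -[RHS]/(0%:E) -Z0 /tmom /Rintegral fineK; last exact: integrable_fin_num (integrable_tmom _ _ _).
  by apply: eq_integral => x _ /=; rewrite expr0 mul1r ger0_norm // ltW // lik_gt0.
have mg : measurable_fun setT (fun x => (f x ^+ 0 * lik r w (f x))%:E).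
  exact: measurable_int (integrable_tmom r w 0).
move/(ae_eq_integral_abs P measurableT mg) => [N [mN N0 sN]].
have : (P setT <= P N)%E.
  rewrite le_measure ?inE // => x _; apply: sN => /= /(_ I) /eqP.
  by rewrite expr0 mul1r eqe gt_eqF // lik_gt0.
by rewrite N0 probability_setT lee_fin ler10.
Qed.

Lemma tmom_le_amom r w n : `|tmom r w n| <= amom r w n.
Proof.
rewrite (le_trans (le_normr_Rintegral _ (integrable_tmom r w n))) //.
rewrite le_Rintegral //; first exact: integrable_norm (integrable_tmom _ _ _).
  exact: integrable_amom.
by move=> x _; rewrite normrM normrX (ger0_norm (ltW (lik_gt0 _ _ _))).
Qed.

(* Chebyshev's association inequality for the comonotone functions [|f|^i]
   and [|f|^j]: compare both with their values at the radius [t] where [|f|^i] takes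
   its mean value. *)
Lemma amom_supermul r w i j : amom r w i * amom r w j <= tmom r w 0%N * amom r w (i + j)%N.
Proof.
case: i => [|i]; first by rewrite amom0.
pose c := amom r w i.+1 / tmom r w 0%N.
have Z0 := tmom0_gt0 r w.
have c0 : 0 <= c by rewrite divr_ge0 ?amom_ge0 // ltW.
pose t := c `^ (i.+1)%:R^-1.
have t0 : 0 <= t by exact: powR_ge0.
have tc : t ^+ i.+1 = c by rewrite -powR_mulrn // -powRrM mulVf // powRr1.
have pos : 0 <= \int[P]_x ((`|f x| ^+ i.+1 - t ^+ i.+1) * (`|f x| ^+ j - t ^+ j) * lik r w (f x)).
  apply: Rintegral_ge0 => x _; rewrite mulr_ge0 //; last exact/ltW/lik_gt0.
  have [le|/ltW le] := lerP (`|f x|) t.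
    by rewrite mulr_le0 // subr_le0 lerXn2r // nnegrE.
  by rewrite mulr_ge0 // subr_ge0 lerXn2r // nnegrE.
have ia := integrable_amom r w.
have E : \int[P]_x ((`|f x| ^+ i.+1 - t ^+ i.+1) * (`|f x| ^+ j - t ^+ j) * lik r w (f x)) =
  amom r w (i.+1 + j)%N - t ^+ i.+1 * amom r w j - (t ^+ j * amom r w i.+1 - t ^+ i.+1 * t ^+ j * amom r w 0%N).
  rewrite /amom -!RintegralZl // -!RintegralB //; first last.
  - exact: integrable_scale.
  - exact: integrable_scale.
  - exact: integrable_scale.
  - by apply: integrable_sub => //; exact: integrable_scale.
  - by apply: integrable_sub => //; exact: integrable_scale.
  by apply: eq_Rintegral => x _; rewrite exprD expr0; ring.
move: pos; rewrite E amom0 tc.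
have -> : amom r w i.+1 = c * tmom r w 0%N by rewrite /c divfK // gt_eqF.
rewrite -(ler_pM2l Z0) mulr0 => pos; rewrite -subr_ge0; apply: le_trans pos _.
by rewrite le_eqVlt; apply/orP; left; apply/eqP; ring.
Qed.

Definition pweight (r w : R) (l : seq nat) : R := wprod (tmom r w) l.

(** Chebyshev's inequality lets the normalised absolute moments serve as the majorant b, and the
    prefactor [Z] cancels the one remaining denominator. The bound is linear in [amom], which
    permits exact averaging over w. *)
Lemma pweight_bound r w l : `|pweight r w l| <= mprod_const l * amom r w (weight l).
Proof.
have Z0 := tmom0_gt0 r w.
rewrite /pweight /wprod normrM gtr0_norm //.
have H : `|mprod (ncum (posterior (tmom r w))) l| <= mprod_const l * (amom r w (weight l) / tmom r w 0%N).
  apply: (mprod_ncum_le _ _ (fun n => amom r w n / tmom r w 0%N)).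
  - by rewrite /posterior divff // gt_eqF.
  - move=> i; rewrite /posterior normrM normfV (gtr0_norm Z0) ler_wpM2r ?tmom_le_amom //.
    by rewrite invr_ge0 ltW.
  - move=> i j; rewrite mulrACA -invfM ler_pdivrMr ?mulr_gt0 //.
    rewrite (le_trans (amom_supermul _ _ _ _)) // le_eqVlt; apply/orP; left; apply/eqP.
    by field; rewrite gt_eqF.
rewrite (le_trans (ler_wpM2l (ltW Z0) H)) // le_eqVlt; apply/orP; left; apply/eqP.
by field; rewrite gt_eqF.
Qed.

End posterior_moments.

(** * Averaging over the observation *)

Section gaussian_average.
Context {R : realType} {d : measure_display} {T : measurableType d}.
Variables (P : probability T R) (f : T -> R).
Hypothesis mf : measurable_fun setT f.
Hypothesis fi : forall n, P.-integrable setT (EFin \o (fun x => f x ^+ n)).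
Local Notation gamma := (@gauss R).
Local Notation tmom := (tmom P f).
Local Notation amom := (amom P f).
Local Notation pweight := (pweight P f).

Lemma lik_mass (r x : R) : (\int[gamma]_w (lik r w x)%:E = 1)%E.
Proof.
transitivity (\int[gamma]_w (cst 1%E (w + r * x)%R : \bar R))%E.
  rewrite (gauss_shift _ (cst 1%E)) //; apply: eq_integral => w _.
  by rewrite mul1e /lik; congr (expR _)%:E; ring.
rewrite /= integral_cst // mul1e; exact: probability_setT.
Qed.

Let mfsnd : measurable_fun setT (fun z : R * T => f z.2) := measurableT_comp mf measurable_snd.

Let G n r (z : R * T) : \bar R := (`|f z.2| ^+ n * lik r z.1 (f z.2))%:E.

Let mG n r : measurable_fun setT (G n r).
Proof.
apply/measurable_EFinP; apply: measurable_funM; last exact: measurable_lik.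
by apply: measurable_funX; exact: measurableT_comp.
Qed.

Let G0 n r z : (0 <= G n r z)%E.
Proof. by rewrite lee_fin mulr_ge0 ?exprn_ge0 // ltW // lik_gt0. Qed.

Let amomE n r w : ((amom r w n)%:E = \int[P]_x G n r (w, x))%E.
Proof.
rewrite /amom /Rintegral fineK //.
exact: integrable_fin_num (integrable_amom _ _ mf fi _ _ _).
Qed.

(** For each x the likelihood is a probability density in w, so exchanging the integrals removes the
    channel and the dependence on r. *)
Lemma ge0_integral_amom n r : (\int[gamma]_w (amom r w n)%:E = \int[P]_x (`|f x| ^+ n)%:E)%E.
Proof.
under eq_integral do rewrite amomE.
rewrite (fubini_tonelli (G n r) (mG n r) (G0 n r)); apply: eq_integral => x _.
rewrite /fubini_G /G /=; under eq_integral do rewrite EFinM.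
rewrite ge0_integralZl ?lik_mass ?mule1 ?lee_fin ?exprn_ge0 //.
- by apply/measurable_EFinP; exact: measurable_lik.
- by move=> w _; rewrite lee_fin ltW // lik_gt0.
Qed.

Lemma abs_moment_fin n : P.-integrable setT (EFin \o (fun x => `|f x| ^+ n)).
Proof.
have := integrable_norm (fi n); apply: eq_integrable => // x _ /=.
by rewrite normrX.
Qed.

Lemma measurable_tmom r n : measurable_fun setT (fun w => tmom r w n).
Proof.
pose H (z : R * T) : \bar R := (f z.2 ^+ n * lik r z.1 (f z.2))%:E.
have mH : measurable_fun setT H.
  apply/measurable_EFinP; apply: measurable_funM; last exact: measurable_lik.
  by apply: measurable_funX.
have iH : (gamma \x P)%E.-integrable setT H.
  apply/integrable12ltyP => //.
  rewrite (_ : integral _ _ _ = \int[gamma]_w (amom r w n)%:E)%E.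
    rewrite ge0_integral_amom; have := integrable_lty measurableT (abs_moment_fin n).
    exact.
  apply: eq_integral => w _; rewrite amomE; apply: eq_integral => x _.
  by rewrite /H /G /= normrM normrX (ger0_norm (ltW (lik_gt0 _ _ _))).
apply/measurable_EFinP.
rewrite (_ : _ \o _ = fubini_F P H); first exact: (measurable_fubini_F iH).
apply/funext => w; rewrite /fubini_F /H /tmom /= /Rintegral fineK //.
exact: integrable_fin_num (integrable_tmom _ _ mf fi _ _ _).
Qed.

Lemma measurable_amom r n : measurable_fun setT (fun w => amom r w n).
Proof.
apply/measurable_EFinP; rewrite (_ : _ \o _ = fubini_F P (G n r)).
  exact: measurable_fun_fubini_tonelli_F.
by apply/funext => w; rewrite /= amomE.
Qed.

Lemma integrable_gauss_amom r n : gamma.-integrable setT (EFin \o (fun w => amom r w n)).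
Proof.
apply/integrableP; split; first by apply/measurable_EFinP; exact: measurable_amom.
rewrite (_ : integral _ _ _ = \int[gamma]_w (amom r w n)%:E)%E.
  by rewrite ge0_integral_amom; have := integrable_lty measurableT (abs_moment_fin n).
by apply: eq_integral => w _ /=; rewrite ger0_norm // amom_ge0.
Qed.

Lemma measurable_pweight r l : measurable_fun setT (fun w => pweight r w l).
Proof.
apply: measurable_funM; first exact: measurable_tmom.
apply: measurable_mprod => n; apply: measurable_ncum => k.
apply: measurable_funM; first exact: measurable_tmom.
(* Inversion becomes the power -1, a measurable function; the two agree because the mass is
   positive. *)
have -> : (fun w => (tmom r w 0%N)^-1) = (@powR R ^~ (-1)) \o (fun w => tmom r w 0%N).
  by apply/funext => w; rewrite /= powR_inv1 // ltW // tmom0_gt0.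
by apply: measurableT_comp; [exact: measurable_powR|exact: measurable_tmom].
Qed.

Lemma integrable_pweight r l : gamma.-integrable setT (EFin \o (fun w => pweight r w l)).
Proof.
apply: (dominated_integrable _ _ _ _ _ (fun w => mprod_const l * amom r w (weight l))) => //.
- exact: measurable_pweight.
- by move=> w; exact: pweight_bound.
- by apply: integrable_scale; exact: integrable_gauss_amom.
Qed.

(** The expectation, over the observation r X + N, of the monomial l in the sign-reversed posterior
    cumulants; the density of the observation sits inside [pweight]. *)
Definition pavg (r : R) (l : seq nat) : R := (\int[gamma]_w pweight r w l)%R.

Definition abs_moment (n : nat) : R := (\int[P]_x (`|f x| ^+ n))%R.

Lemma pavg_bound r l : `|pavg r l| <= mprod_const l * abs_moment (weight l).
Proof.
rewrite (le_trans (le_normr_Rintegral _ (integrable_pweight r l))) //.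
have -> : abs_moment (weight l) = (\int[gamma]_w amom r w (weight l))%R.
  by rewrite /abs_moment /Rintegral -(ge0_integral_amom _ r).
rewrite -RintegralZl //; last exact: integrable_gauss_amom.
apply: le_Rintegral => //.
- exact: integrable_norm (integrable_pweight r l).
- by apply: integrable_scale; exact: integrable_gauss_amom.
- by move=> w _; exact: pweight_bound.
Qed.

End gaussian_average.

(** * Differentiation under the integral and Stein's identity *)

Lemma is_derive_Rintegral (R : realType) (d : measure_display) (T : measurableType d)
    (mu : {measure set T -> \bar R}) (h dh : R -> T -> R) (G : T -> R) (a : R) :
  (forall x, mu.-integrable setT (EFin \o h x)) ->
  (forall (x : R) y, is_derive x 1 (h ^~ y) (dh x y)) ->
  mu.-integrable setT (EFin \o G) ->
  (forall x y, `|x - a| < 1 -> `|dh x y| <= G y) ->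
  is_derive a 1 (fun x => \int[mu]_y h x y)%R (\int[mu]_y dh a y)%R.
Proof.
move=> ih hdh iG dhG.
have Ia : [set` `]a - 1, a + 1[ ] a by rewrite /= in_itv /= ltrBlDr ltrDl ltr01.
have Iab x : [set` `]a - 1, a + 1[ ] x -> `|x - a| < 1.
  by rewrite /= in_itv /= ltr_distl.
have G0 y : 0 <= G y by rewrite (le_trans _ (dhG a y _)) // subrr normr0.
have d1E x y : partial1of2 h x y = dh x y.
  by rewrite partial1of2E; have := hdh x y => ?; rewrite derive_val.
have der x y : [set` `]a - 1, a + 1[ ] x -> setT y -> derivable (h ^~ y) x 1.
  by move=> _ _; have := hdh x y; case.
have bnd x y : [set` `]a - 1, a + 1[ ] x -> setT y -> `|partial1of2 h x y| <= G y.
  by move=> xI _; rewrite d1E dhG // Iab.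
apply: DeriveDef.
  exact: (derivable_under_integral measurableT Ia (fun x _ => ih x) der G0 iG bnd).
rewrite -derive1E (differentiation_under_integral measurableT Ia (fun x _ => ih x) der G0 iG bnd).
by apply: eq_Rintegral => y _; exact: d1E.
Qed.

Section stein.
Context {R : realType}.
Local Notation gamma := (@gauss R).

Lemma integrable_gauss_expR (c : R) : gamma.-integrable setT (EFin \o (fun w : R => expR (c * w))).
Proof.
have il : gamma.-integrable setT (EFin \o (fun w : R => lik 1 w c)).
  apply/integrableP; split; first by apply/measurable_EFinP; exact: measurable_lik.
  rewrite (eq_integral (fun w => (lik 1 w c)%:E)); first by rewrite lik_mass ltry.
  by move=> w _; rewrite /= ger0_norm // ltW // lik_gt0.
have := integrable_scale _ (expR (c ^+ 2 / 2)) _ il; apply: eq_integrable => // w _ /=.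
by rewrite /lik -expRD; congr (expR _)%:E; rewrite !mul1r; ring.
Qed.

Lemma integrable_gauss_expR_abs (c : R) : gamma.-integrable setT (EFin \o (fun w : R => expR (c * `|w|))).
Proof.
apply: (dominated_integrable _ _ _ _ _ (fun w => expR (c * w) + expR (- c * w))).
- apply: measurableT_comp => //; apply: measurable_funM => //; exact: measurableT_comp.
- move=> w; rewrite ger0_norm ?expR_ge0 //.
  have [w0|w0] := ger0P w; first by rewrite lerDl expR_ge0.
  by rewrite mulrN -mulNr lerDr expR_ge0.
- by apply: integrable_add; exact: integrable_gauss_expR.
Qed.

Lemma dominated_gauss_expR (g : R -> R) (C c : R) : measurable_fun setT g ->
  (forall w, `|g w| <= C * expR (c * `|w|)) -> gamma.-integrable setT (EFin \o g).
Proof.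
move=> mg gC; apply: (dominated_integrable _ _ _ _ _ _ mg gC).
by apply: integrable_scale; exact: integrable_gauss_expR_abs.
Qed.

(** The nonnegative shift formula is applied to g + G and to G, and the results are subtracted. *)
Lemma gauss_shift_Rintegral (t : R) (g G : R -> R) : measurable_fun setT g -> measurable_fun setT G ->
  (forall w, `|g w| <= G w) ->
  gamma.-integrable setT (EFin \o (fun w => G (w + t))) ->
  gamma.-integrable setT (EFin \o (fun w => G w * expR (t * w - t ^+ 2 / 2))) ->
  (\int[gamma]_w g (w + t))%R = (\int[gamma]_w (g w * expR (t * w - t ^+ 2 / 2)))%R.
Proof.
move=> mg mG gG iG1 iG2.
have mt : measurable_fun setT (fun x : R => x + t) by exact: measurable_funD.
have me : measurable_fun setT (fun x : R => expR (t * x - t ^+ 2 / 2)).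
  by apply: measurableT_comp => //; apply: measurable_funB => //; exact: measurable_funM.
have ig1 : gamma.-integrable setT (EFin \o (fun w => g (w + t))).
  by apply: (dominated_integrable _ _ _ _ _ _ _ _ iG1) => //; exact: measurableT_comp.
have ig2 : gamma.-integrable setT (EFin \o (fun w => g w * expR (t * w - t ^+ 2 / 2))).
  apply: (dominated_integrable _ _ _ _ _ _ _ _ iG2); first exact: measurable_funM.
  by move=> w; rewrite normrM (ger0_norm (expR_ge0 _)) ler_wpM2r // expR_ge0.
have shiftE (h : R -> R) : measurable_fun setT h -> (forall w, 0 <= h w) ->
    (\int[gamma]_w h (w + t))%R = (\int[gamma]_w (h w * expR (t * w - t ^+ 2 / 2)))%R.
  move=> mh h0; rewrite /Rintegral (gauss_shift _ (EFin \o h)) //; exact/measurable_EFinP.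
have sE1 : (\int[gamma]_w (g (w + t) + G (w + t)))%R =
    (\int[gamma]_w ((g w + G w) * expR (t * w - t ^+ 2 / 2)))%R.
  apply: (shiftE (fun w => g w + G w)); first exact: measurable_funD.
  by move=> w; have := gG w; rewrite ler_norml => /andP[+ _]; lra.
have G0 w : 0 <= G w by exact: le_trans (gG w).
have := shiftE G mG G0; move: sE1; rewrite RintegralD //.
under [in RHS]eq_Rintegral do rewrite mulrDl.
by rewrite RintegralD // => + E; rewrite E => /addIr.
Qed.

Lemma expR_ge_norm (x : R) : `|x| <= expR `|x|.
Proof. by rewrite (le_trans _ (expR_ge1Dx _)) // lerDr. Qed.

(* Stein's identity, obtained by differentiating the shift identity at [t = 0]. *)
Lemma stein (g dg : R -> R) (C c : R) : measurable_fun setT g -> 0 <= C -> 0 <= c ->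
  (forall w : R, is_derive w 1 g (dg w)) ->
  (forall w, `|g w| <= C * expR (c * `|w|)) -> (forall w, `|dg w| <= C * expR (c * `|w|)) ->
  (\int[gamma]_w (w * g w))%R = (\int[gamma]_w dg w)%R.
Proof.
move=> mg C0 c0 gdg gC dgC.
have mt t : measurable_fun setT (fun x : R => x + t) by exact: measurable_funD.
have me t : measurable_fun setT (fun x : R => expR (t * x - t ^+ 2 / 2)).
  by apply: measurableT_comp => //; apply: measurable_funB => //; exact: measurable_funM.
have mabs : measurable_fun setT (fun w : R => expR (c * `|w|)).
  by apply: measurableT_comp => //; apply: measurable_funM => //; exact: measurableT_comp.
have sh (t w : R) : C * expR (c * `|w + t|) <= C * expR (c * `|t|) * expR (c * `|w|).
  rewrite -mulrA ler_wpM2l // -expRD ler_expR -mulrDr ler_wpM2l // addrC; exact: ler_normD.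
have ex (t w : R) : expR (t * w - t ^+ 2 / 2) <= expR (`|t| * `|w|).
  by rewrite ler_expR -normrM (le_trans _ (ler_norm _)) // lerBlDr lerDl divr_ge0 // sqr_ge0.
have gE (t w : R) : C * expR (c * `|w|) * expR (t * w - t ^+ 2 / 2) <= C * expR ((c + `|t|) * `|w|).
  by rewrite -mulrA ler_wpM2l // mulrDl [leRHS]expRD ler_wpM2l ?expR_ge0 ?ex.
have iG1 t : gamma.-integrable setT (EFin \o (fun w : R => C * expR (c * `|w + t|))).
  apply: (dominated_gauss_expR _ (C * expR (c * `|t|)) c).
    by apply: measurable_funM => //; exact: (measurableT_comp mabs (mt t)).
  by move=> w; rewrite ger0_norm // mulr_ge0 // expR_ge0.
have iG2 t : gamma.-integrable setT (EFin \o (fun w : R => C * expR (c * `|w|) * expR (t * w - t ^+ 2 / 2))).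
  apply: (dominated_gauss_expR _ C (c + `|t|)).
    by apply: measurable_funM => //; exact: measurable_funM.
  by move=> w; rewrite ger0_norm // !mulr_ge0 // expR_ge0.
have mG : measurable_fun setT (fun w : R => C * expR (c * `|w|)) by exact: measurable_funM.
have E t := gauss_shift_Rintegral t g _ mg mG gC (iG1 t) (iG2 t).
have d1 : is_derive (0 : R) 1 (fun t : R => \int[gamma]_w g (w + t))%R (\int[gamma]_w dg (w + 0))%R.
  apply: (is_derive_Rintegral _ _ _ _ (fun t w : R => g (w + t)) (fun t w : R => dg (w + t))
    (fun w : R => C * expR c * expR (c * `|w|))).
  - move=> t; apply: (dominated_integrable _ _ _ _ _ _ _ _ (iG1 t)) => //.
    exact: measurableT_comp.
  - move=> t w; have := gdg (w + t) => h.
    have : is_derive t 1 (g \o (fun t : R => w + t)) (dg (w + t) * 1).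
      apply: is_derive1_comp => //.
      have -> : (fun t : R => w + t) = cst w + id :> (R -> R) by [].
      by apply: is_derive_eq; rewrite add0r.
    by rewrite mulr1.
  - by apply: integrable_scale; exact: integrable_gauss_expR_abs.
  - move=> t w; rewrite subr0 => t1; rewrite (le_trans (dgC _)) // (le_trans (sh _ _)) //.
    by rewrite ler_wpM2r ?expR_ge0 // ler_wpM2l // ler_expR ler_piMr // ltW.
have d2 : is_derive (0 : R) 1 (fun t : R => \int[gamma]_w g (w + t))%R
   (\int[gamma]_w (g w * ((w - 0) * expR (0 * w - 0 ^+ 2 / 2))))%R.
  rewrite (_ : (fun t : R => _) = (fun t : R => \int[gamma]_w (g w * expR (t * w - t ^+ 2 / 2)))%R); last exact/funext.
  (* For |t| < 1 one has |w - t| <= |w| + 1 <= expR (|w| + 1) and expR (|t| |w|) <= expR |w|; hence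
     the factor expR 1 and the rate c + 2. *)
  apply: (is_derive_Rintegral _ _ _ _ (fun t w : R => g w * expR (t * w - t ^+ 2 / 2))
    (fun t w : R => g w * ((w - t) * expR (t * w - t ^+ 2 / 2)))
    (fun w : R => C * expR 1 * expR ((c + 2) * `|w|))).
  - move=> t; apply: (dominated_integrable _ _ _ _ _ _ _ _ (iG2 t)) => //.
      exact: measurable_funM.
    by move=> w; rewrite normrM (ger0_norm (expR_ge0 _)) ler_wpM2r // expR_ge0.
  - move=> t w.
    have hd : is_derive t 1 (fun t : R => t * w - t ^+ 2 / 2) (w - t).
      rewrite (_ : (fun t : R => _) = cst w * id - cst (2^-1) * (id * id)); last first.
        by apply/funext => s; rewrite !fctE /=; ring.
      by apply: is_derive_eq; rewrite /GRing.scale /= !fctE; field.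
    have he : is_derive t 1 (expR \o (fun t : R => t * w - t ^+ 2 / 2))
       (expR (t * w - t ^+ 2 / 2) * (w - t)) by exact: is_derive1_comp.
    rewrite (_ : (fun t : R => _) = cst (g w) * (expR \o (fun t : R => t * w - t ^+ 2 / 2))) //.
    by apply: is_derive_eq; rewrite /GRing.scale /=; ring.
  - by apply: integrable_scale; exact: integrable_gauss_expR_abs.
  - move=> t w; rewrite subr0 => t1; rewrite !normrM (ger0_norm (expR_ge0 _)).
    have -> : C * expR 1 * expR ((c + 2) * `|w|) =
      C * expR (c * `|w|) * (expR (`|w| + 1) * expR `|w|).
      rewrite -!mulrA -!expRD; congr (_ * expR _); ring.
    rewrite ler_pM // ?mulr_ge0 ?expR_ge0 // ler_pM ?expR_ge0 //.
      apply: (@le_trans _ _ (`|w| + 1)); last by rewrite (le_trans _ (expR_ge1Dx _)) // lerDr.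
      by rewrite (le_trans (ler_normB _ _)) // lerD2l ltW.
    by rewrite (le_trans (ex _ _)) // ler_expR ler_piMl // ltW.
have := @derive_val _ _ _ _ _ _ _ d1; rewrite (@derive_val _ _ _ _ _ _ _ d2).
under eq_Rintegral do rewrite subr0 mul0r expr0n /= mul0r subr0 expR0 mulr1 mulrC.
by move=> ->; apply: eq_Rintegral => w _; rewrite addr0.
Qed.

End stein.

(** * Majorants and derivatives for the operators A and H *)

Section linear_operators.
Context {R : realType}.
Implicit Types (phi K : seq nat -> R) (l : seq nat).

(** [Amap] with its minus sign turned into plus, so that majorants pass through repeated use of
    [Amap]; [Hmap] has nonnegative coefficients and majorises itself. *)
Definition Apos K l : R := \sum_(b <- dmon l) K b + K (0%N :: l).

Lemma Amap_scale (c : R) phi l : Amap (fun x => c * phi x) l = c * Amap phi l.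
Proof. by rewrite /Amap -mulr_sumr mulrBr. Qed.

Lemma Amap_le phi K D l : (forall x, `|phi x| <= K x * D) -> `|Amap phi l| <= Apos K l * D.
Proof.
move=> pK; rewrite (le_trans (ler_normB _ _)) // mulrDl lerD // mulr_suml.
by rewrite (le_trans (ler_norm_sum _ _ _)) // ler_sum.
Qed.

Lemma Hmap_le phi K D l : (forall x, `|phi x| <= K x * D) -> `|Hmap phi l| <= Hmap K l * D.
Proof.
move=> pK; rewrite /Hmap mulr_suml (le_trans (ler_norm_sum _ _ _)) // ler_sum // => t _.
by rewrite normrM ger0_norm // -mulrA ler_wpM2l.
Qed.

Lemma is_derive_sum_seq (I : Type) (s : seq I) (c : I -> R) (h : I -> R -> R) (dh : I -> R) (t : R) :
  (forall i, is_derive t 1 (h i) (dh i)) ->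
  is_derive t 1 (fun x => \sum_(i <- s) c i * h i x) (\sum_(i <- s) c i * dh i).
Proof.
move=> hd; elim: s => [|i s IH].
  rewrite big_nil (_ : (fun x => _) = cst 0); first exact: is_derive_cst.
  by apply/funext => x; rewrite big_nil.
rewrite big_cons (_ : (fun x => _) = cst (c i) * h i + (fun x => \sum_(i <- s) c i * h i x)); last first.
  by apply/funext => x; rewrite big_cons.
have := hd i => di; apply: is_derive_eq; rewrite /GRing.scale /= mulr0 addr0; ring.
Qed.

Lemma is_derive_Amap (phi : R -> seq nat -> R) (dphi : seq nat -> R) (t : R) l :
  (forall x, is_derive t 1 (fun s => phi s x) (dphi x)) ->
  is_derive t 1 (fun s => Amap (phi s) l) (Amap dphi l).
Proof.
move=> dp; have ds := is_derive_sum_seq _ (dmon l) (fun=> 1) (fun b s => phi s b) dphi t dp.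
rewrite (_ : (fun s => _) = (fun s => \sum_(b <- dmon l) 1 * phi s b) - (fun s => phi s (0%N :: l))); last first.
  by apply/funext => s; rewrite !fctE /Amap; congr (_ - _); apply: eq_bigr => b _; rewrite mul1r.
have := dp (0%N :: l) => d0; apply: is_derive_eq.
by rewrite /Amap; congr (_ - _); apply: eq_bigr => b _; rewrite mul1r.
Qed.

Lemma measurable_sum_seq (d : measure_display) (T : measurableType d) (I : Type) (s : seq I)
    (h : I -> T -> R) : (forall i, measurable_fun setT (h i)) ->
  measurable_fun setT (fun x => \sum_(i <- s) h i x).
Proof. by move=> mh; apply: measurable_sum. Qed.

Lemma integrable_Rintegral_sum_seq (d : measure_display) (T : measurableType d)
    (mu : {measure set T -> \bar R}) (I : Type) (s : seq I) (c : I -> R) (h : I -> T -> R) :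
  (forall i, mu.-integrable setT (EFin \o h i)) ->
  mu.-integrable setT (EFin \o (fun x => \sum_(i <- s) c i * h i x)) /\
  (\int[mu]_x (\sum_(i <- s) c i * h i x))%R = \sum_(i <- s) c i * (\int[mu]_x h i x)%R.
Proof.
move=> ih; elim: s => [|i s [IH1 IH2]].
  split; last by rewrite big_nil; under eq_Rintegral do rewrite big_nil; rewrite Rintegral_cst // mul0r.
  by apply: eq_integrable (integrable0 _ _) => // x _; rewrite /= big_nil.
split.
  have := integrable_add _ _ _ (integrable_scale _ (c i) _ (ih i)) IH1.
  by apply: eq_integrable => // x _; rewrite /= big_cons.
under eq_Rintegral do rewrite big_cons.
rewrite RintegralD // ?RintegralZl // ?big_cons ?IH2 //.
exact: integrable_scale.
Qed.

End linear_operators.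

(** * The flow equation for bounded signals *)

Section bounded_signal.
Context {R : realType} {d : measure_display} {T : measurableType d}.
Variables (P : probability T R) (f : T -> R) (B : R).
Hypothesis mf : measurable_fun setT f.
Hypothesis fB : forall x, `|f x| <= B.
Local Notation gamma := (@gauss R).
Local Notation tmom := (tmom P f).
Local Notation amom := (amom P f).
Local Notation pweight := (pweight P f).

Lemma bounded_moments n : P.-integrable setT (EFin \o (fun x => f x ^+ n)).
Proof.
apply: (dominated_integrable _ _ _ _ _ (cst (B ^+ n))); first exact: measurable_funX.
  by move=> x; rewrite normrX lerXn2r // nnegrE // (le_trans _ (fB x)).
exact: finite_measure_integrable_cst.
Qed.

Let fi := bounded_moments.

Let B0 : 0 <= B.
Proof.
have [x _] : exists x : T, True.
  apply: contrapT => nT; have := @probability_setT _ _ _ P.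
  rewrite (_ : setT = set0) ?measure0; first by move/eqP; rewrite eqe eq_sym oner_eq0.
  by apply/seteqP; split => // x _; apply: nT; exists x.
exact: le_trans (fB x).
Qed.

Lemma lik_bounded r w x : `|x| <= B -> lik r w x <= expR (B * `|r| * `|w|).
Proof.
move=> xB; rewrite ler_expR (@le_trans _ _ (r * w * x)) //.
  by rewrite lerBlDr lerDl divr_ge0 ?sqr_ge0.
rewrite (le_trans (ler_norm _)) // !normrM mulrC -mulrA ler_wpM2r // mulr_ge0 //.
Qed.

Lemma amom_bounded r w n : amom r w n <= B ^+ n * expR (B * `|r| * `|w|).
Proof.
apply: (@le_trans _ _ (\int[P]_x (B ^+ n * expR (B * `|r| * `|w|)))%R); last first.
  by rewrite Rintegral_prob_cst.
apply: le_Rintegral => //; first exact: integrable_amom.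
  exact: finite_measure_integrable_cst.
move=> x _; rewrite ler_pM ?exprn_ge0 ?lik_bounded //; first exact/ltW/lik_gt0.
by rewrite lerXn2r // nnegrE.
Qed.

Definition bconst (l : seq nat) : R := mprod_const l * B ^+ weight l.

Lemma pweight_bounded r w l : `|pweight r w l| <= bconst l * expR (B * `|r| * `|w|).
Proof.
rewrite (le_trans (pweight_bound P f mf fi _ _ _)) // /bconst -mulrA ler_wpM2l ?mprod_const_ge0 //.
exact: amom_bounded.
Qed.

Lemma is_derive_lik_w r (w : R) x : is_derive w 1 (fun w => lik r w x) (r * x * lik r w x).
Proof.
have hd : is_derive w 1 (fun w : R => r * w * x - (r * x) ^+ 2 / 2) (r * x).
  rewrite (_ : (fun w : R => _) = cst (r * x) * id - cst ((r * x) ^+ 2 / 2)); last first.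
    by apply/funext => s; rewrite !fctE /=; ring.
  by apply: is_derive_eq; rewrite /GRing.scale /=; ring.
have : is_derive w 1 (expR \o (fun w : R => r * w * x - (r * x) ^+ 2 / 2))
    (expR (r * w * x - (r * x) ^+ 2 / 2) * (r * x)).
  exact: (is_derive1_comp (is_derive_expR _) hd).
by rewrite [X in is_derive _ _ _ X]mulrC.
Qed.

Lemma is_derive_lik_r (r : R) w x :
  is_derive r 1 (fun r => lik r w x) ((w * x - r * x ^+ 2) * lik r w x).
Proof.
have hd : is_derive r 1 (fun r : R => r * w * x - (r * x) ^+ 2 / 2) (w * x - r * x ^+ 2).
  rewrite (_ : (fun r : R => _) = cst (w * x) * id - cst (x ^+ 2 / 2) * (id * id)); last first.
    by apply/funext => s; rewrite !fctE /=; ring.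
  by apply: is_derive_eq; rewrite /GRing.scale /= !fctE; field.
have : is_derive r 1 (expR \o (fun r : R => r * w * x - (r * x) ^+ 2 / 2))
    (expR (r * w * x - (r * x) ^+ 2 / 2) * (w * x - r * x ^+ 2)).
  exact: (is_derive1_comp (is_derive_expR _) hd).
by rewrite [X in is_derive _ _ _ X]mulrC.
Qed.

Lemma is_derive_tmom_w r (w : R) n : is_derive w 1 (fun w => tmom r w n) (r * tmom r w n.+1).
Proof.
rewrite -RintegralZl //; last exact: integrable_tmom.
apply: (is_derive_Rintegral _ _ _ _ (fun w x => f x ^+ n * lik r w (f x))
  (fun w x => r * (f x ^+ n.+1 * lik r w (f x)))
  (cst (`|r| * (B ^+ n.+1 * expR (B * `|r| * (`|w| + 1)))))).
- by move=> v; exact: integrable_tmom.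
- move=> v x; have := is_derive_lik_w r v (f x) => hd.
  rewrite (_ : (fun v => _) = cst (f x ^+ n) * (fun v => lik r v (f x))) //.
  by apply: is_derive_eq; rewrite /GRing.scale /= exprS; ring.
- exact: finite_measure_integrable_cst.
- move=> v x vw /=; rewrite !normrM ler_wpM2l // ler_pM // ?normrX.
    by rewrite lerXn2r // nnegrE.
  rewrite ger0_norm ?(ltW (lik_gt0 _ _ _)) // (le_trans (lik_bounded _ _ _ (fB x))) //.
  rewrite ler_expR ler_wpM2l ?mulr_ge0 //.
  by rewrite -[v](subrK w) (le_trans (ler_normD _ _)) // addrC lerD2l ltW.
Qed.

Lemma is_derive_tmom_r (r : R) w n :
  is_derive r 1 (fun r => tmom r w n) (w * tmom r w n.+1 + - r * tmom r w n.+2).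
Proof.
rewrite -!RintegralZl //; try exact: integrable_tmom.
rewrite -RintegralD //; try by apply: integrable_scale; exact: integrable_tmom.
apply: (is_derive_Rintegral _ _ _ _ (fun r x => f x ^+ n * lik r w (f x))
  (fun r x => w * (f x ^+ n.+1 * lik r w (f x)) + - r * (f x ^+ n.+2 * lik r w (f x)))
  (cst (`|w| * (B ^+ n.+1 * expR (w ^+ 2 / 2)) + (`|r| + 1) * (B ^+ n.+2 * expR (w ^+ 2 / 2))))).
- by move=> v; exact: integrable_tmom.
- move=> v x; have := is_derive_lik_r v w (f x) => hd.
  rewrite (_ : (fun v => _) = cst (f x ^+ n) * (fun v => lik v w (f x))) //.
  by apply: is_derive_eq; rewrite /GRing.scale /= !exprS; ring.
- exact: finite_measure_integrable_cst.
- have le k v x : `|f x ^+ k * lik v w (f x)| <= B ^+ k * expR (w ^+ 2 / 2).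
    rewrite normrM normrX (ger0_norm (ltW (lik_gt0 _ _ _))) ler_pM ?lik_le //.
    - exact/ltW/lik_gt0.
    - by rewrite lerXn2r // nnegrE.
  move=> v x vr /=; rewrite (le_trans (ler_normD _ _)) // lerD //.
    by rewrite normrM ler_wpM2l.
  rewrite normrM normrN ler_pM //.
  by rewrite -[v](subrK r) (le_trans (ler_normD _ _)) // addrC lerD2l ltW.
Qed.

Lemma is_derive_pweight_w r (w : R) l :
  is_derive w 1 (fun w => pweight r w l) (r * Amap (pweight r w) l).
Proof.
have Z0 : tmom r w 0%N != 0 by rewrite gt_eqF // tmom0_gt0.
have dZ n : is_derive w 1 (fun w => tmom r w n) (r * tmom r w n.+1 + 0 * tmom r w n.+2).
  by rewrite mul0r addr0; exact: is_derive_tmom_w.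
by have := is_derive_wprod (fun w => tmom r w) w r 0 l Z0 dZ; rewrite mul0r addr0.
Qed.

Lemma is_derive_pweight_r (r : R) w l :
  is_derive r 1 (fun r => pweight r w l)
    (w * Amap (pweight r w) l + - r * (Amap (Amap (pweight r w)) l - Hmap (pweight r w) l)).
Proof.
have Z0 : tmom r w 0%N != 0 by rewrite gt_eqF // tmom0_gt0.
exact: (is_derive_wprod (fun r => tmom r w) r w (- r) l Z0 (is_derive_tmom_r r w)).
Qed.

(** Under the Gaussian integral the r-derivative is w A - r (A^2 - H). Stein's identity trades the
    factor w for a w-derivative, which acts as r A on weighted monomials; so w A averages to r A^2,
    and r H is left. *)
Lemma is_derive_pavg (r : R) l :
  is_derive r 1 (fun r => pavg P f r l) (r * Hmap (pavg P f r) l).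
Proof.
pose K1 := Apos bconst; pose K2 := Apos K1; pose K3 := Hmap bconst.
have b1 s w x : `|Amap (pweight s w) x| <= K1 x * expR (B * `|s| * `|w|).
  by apply: Amap_le => y; exact: pweight_bounded.
have b2 s w x : `|Amap (Amap (pweight s w)) x| <= K2 x * expR (B * `|s| * `|w|).
  by apply: Amap_le => y; exact: b1.
have b3 s w x : `|Hmap (pweight s w) x| <= K3 x * expR (B * `|s| * `|w|).
  by apply: Hmap_le => y; exact: pweight_bounded.
clearbody K2 K1 K3.
have K0 (phi : seq nat -> R) (K : seq nat -> R) x : `|phi x| <= K x * expR (B * `|r| * `|(0:R)|) -> 0 <= K x.
  by move=> /(le_trans (normr_ge0 _)); rewrite pmulr_lge0 // expR_gt0.
have K10 x : 0 <= K1 x := K0 _ K1 x (b1 r 0 x).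
have K20 x : 0 <= K2 x := K0 _ K2 x (b2 r 0 x).
have K30 x : 0 <= K3 x := K0 _ K3 x (b3 r 0 x).
have mA0 s x : measurable_fun setT (fun w => Amap (pweight s w) x).
  apply: measurable_funB; last exact: measurable_pweight.
  by apply: measurable_sum_seq => y; exact: measurable_pweight.
have mA1 s x : measurable_fun setT (fun w => Amap (Amap (pweight s w)) x).
  by apply: measurable_funB => //; apply: measurable_sum_seq => y.
have iAA : gamma.-integrable setT (EFin \o (fun w => Amap (Amap (pweight r w)) l)).
  exact: dominated_gauss_expR (mA1 r l) (fun w => b2 r w l).
have [iH EH] := integrable_Rintegral_sum_seq _ _ gamma _ (Hmon l) (fun t => t.1%:R)
  (fun t w => pweight r w t.2) (fun t => integrable_pweight P f mf fi r t.2).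
have {}iH : gamma.-integrable setT (EFin \o (fun w => Hmap (pweight r w) l)) by exact: iH.
have {}EH : (\int[gamma]_w Hmap (pweight r w) l)%R = Hmap (pavg P f r) l by exact: EH.
have iwA : gamma.-integrable setT (EFin \o (fun w => w * Amap (pweight r w) l)).
  apply: (dominated_gauss_expR _ (K1 l) (B * `|r| + 1)); first exact: measurable_funM.
  move=> w; rewrite normrM mulrDl mul1r expRD mulrA mulrC ler_pM ?b1 //; exact: expR_ge_norm.
have st : (\int[gamma]_w (w * Amap (pweight r w) l))%R =
    (\int[gamma]_w (r * Amap (Amap (pweight r w)) l))%R.
  apply: (stein _ _ (K1 l + `|r| * K2 l) (B * `|r|)) => //.
  - by rewrite addr_ge0 // mulr_ge0.
  - by rewrite mulr_ge0.
  - move=> w; rewrite (_ : r * _ = Amap (fun x => r * Amap (pweight r w) x) l).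
      by apply: is_derive_Amap => x; exact: is_derive_pweight_w.
    by rewrite Amap_scale.
  - move=> w; rewrite (le_trans (b1 _ _ _)) // ler_wpM2r ?expR_ge0 // lerDl mulr_ge0 //.
  - move=> w; rewrite normrM (le_trans (ler_wpM2l _ (b2 _ _ _))) // mulrA ler_wpM2r ?expR_ge0 //.
    by rewrite lerDr.
have -> : r * Hmap (pavg P f r) l = (\int[gamma]_w (w * Amap (pweight r w) l +
    - r * (Amap (Amap (pweight r w)) l - Hmap (pweight r w) l)))%R.
  rewrite RintegralD //; last by apply: integrable_scale; exact: integrable_sub.
  rewrite st !RintegralZl //; last exact: integrable_sub.
  by rewrite (RintegralB measurableT iAA iH) EH; ring.
(* A rate valid for all s within distance 1 of r; the additional 1 in [c + 1] absorbs the factor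
   w. *)
pose c := B * (`|r| + 1).
apply: (is_derive_Rintegral _ _ _ _ (fun r w => pweight r w l)
  (fun r w => w * Amap (pweight r w) l + - r * (Amap (Amap (pweight r w)) l - Hmap (pweight r w) l))
  (fun w => (K1 l + (`|r| + 1) * (K2 l + K3 l)) * expR ((c + 1) * `|w|))).
- by move=> s; exact: integrable_pweight.
- by move=> s w; exact: is_derive_pweight_r.
- by apply: integrable_scale; exact: integrable_gauss_expR_abs.
- move=> s w sr.
  have s1 : `|s| <= `|r| + 1.
    by rewrite -[s](subrK r) (le_trans (ler_normD _ _)) // addrC lerD2l ltW.
  have ec : expR (B * `|s| * `|w|) <= expR (c * `|w|).
    by rewrite ler_expR ler_wpM2r // ler_wpM2l.
  have ec1 : expR (c * `|w|) <= expR ((c + 1) * `|w|).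
    by rewrite ler_expR ler_wpM2r // lerDl.
  rewrite (le_trans (ler_normD _ _)) // mulrDl lerD //.
    rewrite normrM mulrC mulrDl mul1r expRD mulrA ler_pM ?expR_ge_norm //.
    by rewrite (le_trans (b1 _ _ _)) // ler_wpM2l.
  rewrite normrM normrN -mulrA ler_pM // (le_trans (ler_normB _ _)) // mulrDl lerD //.
    by rewrite (le_trans (b2 _ _ _)) // ler_wpM2l // (le_trans ec).
  by rewrite (le_trans (b3 _ _ _)) // ler_wpM2l // (le_trans ec).
Qed.

End bounded_signal.

(** * Taylor expansion with remainder *)

Section taylor.
Context {R : realType}.
Implicit Types (phi : R -> seq nat -> R) (K : seq nat -> R) (l : seq nat).

(** Coefficients of exp(r^2 H / 2), the formal solution of d/dr = r H. *)
Definition tcoef (k : nat) : R := ((2 ^ k)%N * k`!)%N%:R^-1.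

Lemma tcoef_gt0 k : 0 < tcoef k.
Proof. by rewrite invr_gt0 ltr0n muln_gt0 expn_gt0 fact_gt0. Qed.

Lemma tcoefS k : (2 * k.+1)%N%:R * tcoef k.+1 = tcoef k.
Proof.
rewrite /tcoef expnS factS.
have -> : (2 * 2 ^ k * (k.+1 * k`!) = 2 * k.+1 * (2 ^ k * k`!))%N by lia.
by rewrite [in X in _ * X]natrM invfM mulrA divff ?mul1r // pnatr_eq0 muln_eq0.
Qed.

Definition texp K N (r : R) l : R :=
  \sum_(k < N) tcoef k * r ^+ (2 * k) * iter k Hmap K l.

Lemma Hmap_sub (psi : seq nat -> R) K l : Hmap (fun x => psi x - K x) l = Hmap psi l - Hmap K l.
Proof. by rewrite /Hmap -sumrB; apply: eq_bigr => t _; rewrite mulrBr. Qed.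

Lemma Hmap_texp K N r l : Hmap (texp K N r) l = \sum_(k < N) tcoef k * r ^+ (2 * k) * iter k.+1 Hmap K l.
Proof.
rewrite /Hmap /texp; under eq_bigr do rewrite mulr_sumr.
rewrite exchange_big /=; apply: eq_bigr => k _; rewrite mulr_sumr.
by apply: eq_bigr => t _; rewrite mulrCA.
Qed.

Lemma is_derive_texp K N (r : R) l :
  is_derive r 1 (fun r => texp K N.+1 r l) (r * Hmap (texp K N r) l).
Proof.
rewrite Hmap_texp mulr_sumr.
have -> : (fun r => texp K N.+1 r l) = cst (K l) +
    \sum_(k < N) (cst (tcoef k.+1 * iter k.+1 Hmap K l) * (id ^+ (2 * k.+1))).
  apply/funext => s; rewrite /texp big_ord_recl /= !fctE fct_sumE muln0 expr0 mulr1.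
  rewrite /tcoef expn0 fact0 invr1 mul1r; congr (_ + _); apply: eq_bigr => k _.
  by rewrite !fctE /bump /= add1n mulrAC.
have dk (k : 'I_N) : is_derive r 1 (cst (tcoef k.+1 * iter k.+1 Hmap K l) * (id ^+ (2 * k.+1)) : R -> R)
    (r * (tcoef k * r ^+ (2 * k) * iter k.+1 Hmap K l)).
  apply: is_derive_eq; rewrite /GRing.scale /= mulr0 addr0 -(tcoefS k).
  have -> : r ^+ (2 * k.+1).-1 = r * r ^+ (2 * k) by rewrite -exprS mulnS.
  by move: (_%:R) => q; ring.
by apply: is_derive_eq; rewrite add0r.
Qed.

(** Induction on N for all monomials at once: the remainder of order N + 1 vanishes at 0 and its
    derivative is r times H of the remainder of order N, so the mean value theorem applies. It loses
    the factorial, which identifying coefficients does not require. *)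
Lemma taylor_flow phi K : (forall l (r : R), is_derive r 1 (fun r => phi r l) (r * Hmap (phi r) l)) ->
  (forall l r, `|phi r l| <= K l) ->
  forall N l r, 0 <= r -> `|phi r l - texp (phi 0) N r l| <= iter N Hmap K l * r ^+ (2 * N).
Proof.
move=> dphi phiK; elim=> [|N IH] l r r0.
  by rewrite /texp big_ord0 subr0 muln0 expr0 mulr1; exact: phiK.
move: r0; rewrite le_eqVlt => /predU1P[<-|r0].
  rewrite /texp big_ord_recl big1 => [|k _]; last by rewrite mulnS /= expr0n mulr0 mul0r.
  by rewrite /= /tcoef expn0 fact0 invr1 muln0 expr0 !mul1r addr0 subrr normr0 mulnS expr0n mulr0.
pose u s := phi s l - texp (phi 0) N.+1 s l.
pose du s := s * Hmap (fun x => phi s x - texp (phi 0) N s x) l.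
have u' (s : R) : is_derive s 1 u (du s).
  have h1 := dphi l s; have h2 := is_derive_texp (phi 0) N s l.
  have -> : u = (fun r => phi r l) - (fun r => texp (phi 0) N.+1 r l) by [].
  by apply: is_derive_eq; rewrite /du Hmap_sub mulrBr.
have u0 : u 0 = 0.
  rewrite /u /texp big_ord_recl big1 => [|k _]; last by rewrite mulnS /= expr0n mulr0 mul0r.
  by rewrite /= /tcoef expn0 fact0 invr1 muln0 expr0 !mul1r addr0 subrr.
have cu : {within `[0, r], continuous u}.
  apply: derivable_within_continuous => s _; by have := u' s; case.
have [c + E] := @MVT _ u du 0 r r0 (fun s _ => u' s) cu.
rewrite in_itv /= => /andP[c0 cr].
rewrite -/(u r) -[u r]subr0 -u0 E subr0 normrM (gtr0_norm r0) /du normrM (gtr0_norm c0).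
have Hc : `|Hmap (fun x => phi c x - texp (phi 0) N c x) l| <= iter N.+1 Hmap K l * c ^+ (2 * N).
  by rewrite iterS; apply: Hmap_le => x; apply: IH; exact: ltW.
have Hr : `|Hmap (fun x => phi c x - texp (phi 0) N c x) l| <= iter N.+1 Hmap K l * r ^+ (2 * N).
  rewrite (le_trans Hc) // ler_wpM2l //; last by rewrite lerXn2r // ?nnegrE ltW.
  (* The sign of the majorant is read off from [Hc], where it bounds an absolute value and c > 0. *)
  by move: (le_trans (normr_ge0 _) Hc); rewrite pmulr_lge0 // exprn_gt0.
have -> : iter N.+1 Hmap K l * r ^+ (2 * N.+1) = r * (iter N.+1 Hmap K l * r ^+ (2 * N)) * r.
  by rewrite mulnS !exprS; ring.
by rewrite ler_wpM2r ?(ltW r0) // ler_pM ?(ltW c0) ?(ltW cr).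
Qed.

Lemma peval_flow (u : nat -> R) k : peval u (flow k) = iter k Hmap (mprod u) [:: 1%N].
Proof.
rewrite /peval /flow; have H p : \sum_(t <- iter k Hpol p) t.1%:R * mprod u t.2 =
    \sum_(t <- p) t.1%:R * iter k Hmap (mprod u) t.2.
  elim: k (mprod u) p => // k IH g p.
  by rewrite iterS sum_Hpol IH -iterSr.
by rewrite H big_seq1 mul1r.
Qed.

End taylor.

(** * From truncated signals to signals with moments *)

Lemma cvg_sum_seq (R : realType) (I : Type) (s : seq I) (h : nat -> I -> R) (h' : I -> R) :
  (forall i, h n i @[n --> \oo] --> h' i) ->
  \sum_(i <- s) h n i @[n --> \oo] --> \sum_(i <- s) h' i.
Proof.
move=> hh; elim: s => [|i s IH].
  by under eq_fun do rewrite big_nil; rewrite big_nil; exact: cvg_cst.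
by under eq_fun do rewrite big_cons; rewrite big_cons; apply: cvgD.
Qed.

Section truncation.
Context {R : realType} {d : measure_display} {T : measurableType d}.
Variables (P : probability T R) (f : T -> R).
Hypothesis mf : measurable_fun setT f.
Hypothesis fi : forall n, P.-integrable setT (EFin \o (fun x => f x ^+ n)).
Local Notation gamma := (@gauss R).

(** Large values are sent to 0, not clipped: each value is either that of [f] or one where the
    likelihood equals 1. *)
Definition trunc (n : nat) (x : T) : R := if `|f x| <= n%:R then f x else 0.

Lemma measurable_trunc n : measurable_fun setT (trunc n).
Proof.
apply: measurable_fun_ifT => //.
by apply: measurable_fun_ler => //; exact: measurableT_comp.
Qed.

Lemma trunc_bounded n x : `|trunc n x| <= n%:R.
Proof. by rewrite /trunc; case: ifPn => //; rewrite normr0. Qed.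

Lemma trunc_le n x : `|trunc n x| <= `|f x|.
Proof. by rewrite /trunc; case: ifPn => // _; rewrite normr0. Qed.

Lemma trunc_near x : \forall n \near \oo, trunc n x = f x.
Proof.
near=> n; rewrite /trunc ifT //.
by near: n; exact: nbhs_infty_ger.
Unshelve. all: by end_near. Qed.

Let ti n := bounded_moments P (trunc n) n%:R (measurable_trunc n) (trunc_bounded n).

Lemma cvg_tmom_trunc r w k : tmom P (trunc n) r w k @[n --> \oo] --> tmom P f r w k.
Proof.
apply: fine_cvg; rewrite fineK; last exact: integrable_fin_num (integrable_tmom _ _ mf fi _ _ _).
apply: (@dominated_cvg _ _ _ P setT measurableT
  (fun n x => (trunc n x ^+ k * lik r w (trunc n x))%:E) _
  (fun x => (`|f x| ^+ k * expR (w ^+ 2 / 2))%:E)) => //.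
- move=> n; exact: measurable_int (integrable_tmom _ _ (measurable_trunc n) (ti n) _ _ _).
- move=> x _; apply: cvg_near_cst; near=> n.
  by rewrite (_ : trunc n x = f x) //; near: n; exact: trunc_near.
- have := integrable_scale _ (expR (w ^+ 2 / 2)) _ (abs_moment_fin P f fi k).
  by apply: eq_integrable => // x _; rewrite /= mulrC.
- move=> n x _; rewrite lee_fin normrM normrX ler_pM //.
    by rewrite lerXn2r // ?nnegrE // trunc_le.
  by rewrite ger0_norm ?lik_le // ltW // lik_gt0.
Unshelve. all: by end_near. Qed.

Lemma cvg_ncum (m : nat -> nat -> R) (m' : nat -> R) :
  (forall k, m n k @[n --> \oo] --> m' k) ->
  forall k, ncum (m n) k @[n --> \oo] --> ncum m' k.
Proof.
move=> mm k; have [j] := ubnP k; elim: j k => // j IH k; rewrite ltnS => kj.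
under eq_fun do rewrite ncumE; rewrite ncumE.
apply: cvgB; first exact: cvgN.
apply: cvg_sum_seq => i; apply: cvgM; last exact: mm.
by apply: cvgM; [exact: cvg_cst|apply: IH; exact: leq_trans kj].
Qed.

Lemma cvg_mprod (u : nat -> nat -> R) (u' : nat -> R) l :
  (forall k, u n k @[n --> \oo] --> u' k) -> mprod (u n) l @[n --> \oo] --> mprod u' l.
Proof.
move=> uu; elim: l => [|i l IH].
  under eq_fun do rewrite /mprod big_nil; rewrite /mprod big_nil; exact: cvg_cst.
by under eq_fun do rewrite mprod_cons; rewrite mprod_cons; apply: cvgM.
Qed.

Lemma cvg_pweight_trunc r w l : pweight P (trunc n) r w l @[n --> \oo] --> pweight P f r w l.
Proof.
have ct := cvg_tmom_trunc r w.
apply: cvgM; first exact: ct.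
apply: (cvg_mprod (fun n => ncum (posterior (tmom P (trunc n) r w)))).
apply: (cvg_ncum (fun n => posterior (tmom P (trunc n) r w))) => k.
apply: cvgM; first exact: ct.
by apply: cvgV => //; rewrite gt_eqF // tmom0_gt0.
Qed.

(** The added 1 covers the points sent to 0, where the integrand is 0^k. The majorant is free of n,
    as dominated convergence in w requires. *)
Lemma amom_trunc_le n r w k : amom P (trunc n) r w k <= amom P f r w k + 1.
Proof.
have -> : amom P f r w k + 1 = (\int[P]_x (`|f x| ^+ k * lik r w (f x) + 1))%R.
  rewrite RintegralD //; first last.
  - exact: finite_measure_integrable_cst.
  - exact: integrable_amom.
  by rewrite Rintegral_prob_cst.
apply: le_Rintegral => //.
- exact: integrable_amom (measurable_trunc n) (ti n) _ _ _.
- apply: integrable_add; first exact: integrable_amom.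
  exact: finite_measure_integrable_cst.
- move=> x _; rewrite /trunc; case: ifPn => _; first by rewrite lerDl.
  rewrite normr0 /lik !mulr0 [0 ^+ 2]expr0n /= mul0r subr0 expR0 mulr1 (@le_trans _ _ 1) //.
    by case: k => [|k]; rewrite ?expr0 // expr0n.
  by rewrite lerDr mulr_ge0 ?exprn_ge0 ?expR_ge0.
Qed.

Lemma cvg_pavg_trunc r l : pavg P (trunc n) r l @[n --> \oo] --> pavg P f r l.
Proof.
apply: fine_cvg; rewrite fineK; last first.
  exact: integrable_fin_num (integrable_pweight P f mf fi r l).
apply: (@dominated_cvg _ _ _ gamma setT measurableT
  (fun n w => (pweight P (trunc n) r w l)%:E) _
  (fun w => (mprod_const l * (amom P f r w (weight l) + 1))%:E)) => //.
- by move=> n; apply/measurable_EFinP; apply: measurable_pweight => //; exact: measurable_trunc.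
- move=> w _; apply: cvg_EFin; first exact: nearW.
  exact: cvg_pweight_trunc.
- apply: integrable_scale; apply: integrable_add; last exact: finite_measure_integrable_cst.
  exact: integrable_gauss_amom.
- move=> n w _; rewrite lee_fin (le_trans (pweight_bound _ _ (measurable_trunc n) (ti n) _ _ _)) //.
  by rewrite ler_wpM2l ?mprod_const_ge0 // amom_trunc_le.
Qed.

Lemma abs_moment_trunc n k : abs_moment P (trunc n) k <= abs_moment P f k.
Proof.
apply: le_Rintegral => //; first exact: abs_moment_fin.
  exact: abs_moment_fin.
by move=> x _; rewrite lerXn2r // ?nnegrE // trunc_le.
Qed.

Definition mbound l : R := mprod_const l * abs_moment P f (weight l).

Lemma cvg_iter_Hmap (g : nat -> seq nat -> R) (g' : seq nat -> R) k l :
  (forall l, g n l @[n --> \oo] --> g' l) ->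
  iter k Hmap (g n) l @[n --> \oo] --> iter k Hmap g' l.
Proof.
move=> gg; elim: k l => //= k IH l; apply: cvg_sum_seq => t.
by apply: cvgM; [exact: cvg_cst|exact: IH].
Qed.

(** The flow equation is known for the truncations only; truncation decreases absolute moments, so
    [mbound] serves for all of them and for the limit. *)
Theorem pavg_expansion N l r : 0 <= r ->
  `|pavg P f r l - texp (pavg P f 0) N r l| <= iter N Hmap mbound l * r ^+ (2 * N).
Proof.
move=> r0.
have Hn n : `|pavg P (trunc n) r l - texp (pavg P (trunc n) 0) N r l| <= iter N Hmap mbound l * r ^+ (2 * N).
  apply: taylor_flow => // [x s|x s].
    exact: is_derive_pavg (measurable_trunc n) (trunc_bounded n) _ _.
  rewrite (le_trans (pavg_bound _ _ (measurable_trunc n) (ti n) _ _)) // ler_wpM2l ?mprod_const_ge0 //.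
  exact: abs_moment_trunc.
have cv : `|pavg P (trunc n) r l - texp (pavg P (trunc n) 0) N r l| @[n --> \oo] -->
    `|pavg P f r l - texp (pavg P f 0) N r l|.
  apply: cvg_norm; apply: cvgB; first exact: cvg_pavg_trunc.
  apply: cvg_sum_seq => k; apply: cvgM; first exact: cvg_cst.
  by apply: cvg_iter_Hmap => x; exact: cvg_pavg_trunc.
by apply: (cvgr_to_le cv); apply: nearW => n; exact: Hn.
Qed.

(** At r = 0 the observation is pure noise and the posterior is the prior. *)
Lemma pavg0 l : pavg P f 0 l = mprod (ncum (fun n => (\int[P]_x f x ^+ n)%R)) l.
Proof.
have E w n : tmom P f 0 w n = (\int[P]_x f x ^+ n)%R.
  by apply: eq_Rintegral => x _; rewrite /lik !mul0r expr0n /= mul0r subr0 expR0 mulr1.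
have E0 : (\int[P]_x f x ^+ 0)%R = 1 :> R.
  by rewrite -[RHS](Rintegral_prob_cst P); apply: eq_Rintegral => x _; rewrite expr0.
rewrite /pavg /pweight /wprod.
under eq_Rintegral => w _.
  rewrite E E0 mul1r.
  have -> : posterior (tmom P f 0 w) = fun n => (\int[P]_x f x ^+ n)%R.
    by apply/funext => n; rewrite /posterior !E E0 divr1.
  over.
exact: Rintegral_prob_cst.
Qed.

End truncation.

(** * Uniqueness of the coefficients *)

Lemma expansion_unique (R : realType) (a b M : nat -> R) :
  (forall N r, 0 < r ->
     `|\sum_(k < N) tcoef k * r ^+ (2 * k) * (a k - b k)| <= M N * r ^+ (2 * N)) ->
  a =1 b.
Proof.
move=> H k; have [j] := ubnP k; elim: j k => // j IH k; rewrite ltnS => kj.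
have tk := @tcoef_gt0 R k.
have Hk r : 0 < r -> tcoef k * `|a k - b k| <= M k.+1 * r ^+ 2.
  move=> r0; have := H k.+1 r r0; rewrite big_ord_recr /= big1 => [|i _]; last first.
    by rewrite IH ?subrr ?mulr0 // (leq_trans (ltn_ord i)).
  have r2k : 0 < r ^+ (2 * k) by rewrite exprn_gt0.
  rewrite add0r !normrM (gtr0_norm tk) (gtr0_norm r2k) mulrAC.
  by rewrite mulnS exprD mulrA ler_pM2r.
apply/eqP; rewrite -subr_eq0 -normr_le0; apply/ler_addgt0Pl => e e0; rewrite addr0.
(* Chosen so that |M| r^2 <= tcoef * e; the added 1 keeps the denominator positive. *)
pose r := Num.sqrt (tcoef k * e / (`|M k.+1| + 1)).
have M1 : 0 < `|M k.+1| + 1 by rewrite ltr_wpDl.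
have r0 : 0 < r by rewrite sqrtr_gt0 divr_gt0 // mulr_gt0.
rewrite -(ler_pM2l tk) (le_trans (Hk r r0)) // sqr_sqrtr; last by rewrite ltW // divr_gt0 // mulr_gt0.
rewrite mulrCA ler_piMr ?(ltW (mulr_gt0 tk e0)) // ler_pdivrMr // mul1r.
by rewrite (le_trans (ler_norm _)) // lerDl.
Qed.

Lemma flow_of_pavg (R : realType) (d1 d2 : measure_display)
    (T1 : measurableType d1) (T2 : measurableType d2)
    (P1 : probability T1 R) (P2 : probability T2 R) (f1 : T1 -> R) (f2 : T2 -> R) :
  measurable_fun setT f1 -> (forall n, P1.-integrable setT (EFin \o (fun x => f1 x ^+ n))) ->
  measurable_fun setT f2 -> (forall n, P2.-integrable setT (EFin \o (fun x => f2 x ^+ n))) ->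
  (forall r, 0 < r -> pavg P1 f1 r [:: 1%N] = pavg P2 f2 r [:: 1%N]) ->
  forall k, peval (ncum (fun n => (\int[P1]_x f1 x ^+ n)%R)) (flow k) =
            peval (ncum (fun n => (\int[P2]_x f2 x ^+ n)%R)) (flow k).
Proof.
move=> mf1 fi1 mf2 fi2 E k; rewrite !peval_flow.
have -> : mprod (ncum (fun n => (\int[P1]_x f1 x ^+ n)%R)) = pavg P1 f1 0.
  by apply/funext => l; rewrite pavg0.
have -> : mprod (ncum (fun n => (\int[P2]_x f2 x ^+ n)%R)) = pavg P2 f2 0.
  by apply/funext => l; rewrite pavg0.
move: k; apply: (expansion_unique _ _ _ (fun N =>
  iter N Hmap (mbound P1 f1) [:: 1%N] + iter N Hmap (mbound P2 f2) [:: 1%N])) => N r r0.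
have := pavg_expansion P1 f1 mf1 fi1 N [:: 1%N] r (ltW r0).
have := pavg_expansion P2 f2 mf2 fi2 N [:: 1%N] r (ltW r0).
rewrite E // mulrDl /texp.
under [in X in _ -> _ -> X]eq_bigr do rewrite mulrBr.
have triangle (q A B x y : R) : `|q - B| <= y -> `|q - A| <= x -> `|A - B| <= x + y.
  move=> hB hA; have -> : A - B = (q - B) - (q - A) by ring.
  by rewrite (le_trans (ler_normB _ _)) // addrC lerD.
by rewrite sumrB => hB hA; exact: triangle hB hA.
Qed.

(** * The Gaussian channel and the mmse *)

Section channel.
Context {R : realType}.
Variables (mu : probability R R) (s : R).
Local Notation gamma := (@gauss R).
Local Notation r := (Num.sqrt s).
Local Notation J := (mu \x @gauss R)%E.

Lemma measurable_chan : measurable_fun setT (chan s : R * R -> R).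
Proof. by apply: measurable_funD => //; exact: measurable_funM. Qed.

(** For fixed x the shift r x turns the noise coordinate into the observation: the pair (X, Y_s) has
    density [lik] relative to the product of [mu] and the standard Gaussian. *)
Lemma ge0_integral_chan (psi : R * R -> \bar R) : measurable_fun setT psi ->
  (forall z, (0 <= psi z)%E) ->
  (\int[J]_z psi (z.1, chan s z) = \int[gamma]_w \int[mu]_x (psi (x, w) * (lik r w x)%:E))%E.
Proof.
move=> mpsi psi0.
have mch : measurable_fun setT (fun z : R * R => (z.1, chan s z)).
  exact: (measurable_fun_pair measurable_fst measurable_chan).
have mlik : measurable_fun setT (fun z : R * R => (lik r z.2 z.1)%:E).
  by apply/measurable_EFinP; exact: measurable_lik.
rewrite (fubini_tonelli1 (fun z => psi (z.1, chan s z))) //; last exact: (measurableT_comp mpsi mch).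
rewrite -(fubini_tonelli (fun z => psi z * (lik r z.2 z.1)%:E)%E); first last.
- by move=> z; rewrite mule_ge0 // lee_fin ltW // lik_gt0.
- exact: emeasurable_funM.
apply: eq_integral => x _; rewrite /fubini_F /=.
have mx : measurable_fun setT (fun w : R => psi (x, w)).
  apply: (measurableT_comp mpsi); exact: measurable_fun_pair.
have := gauss_shift (r * x) (fun w => psi (x, w)) mx (fun w => psi0 (x, w)).
rewrite /chan /= => E.
under eq_integral do rewrite addrC.
rewrite E; apply: eq_integral => w _; congr (_ * (expR _)%:E)%E; rewrite /=; ring.
Qed.

(** Adding |p| + |q| to both functions reduces to the nonnegative case; its finite integral cancels
    at the end. *)
Lemma integral_chan_eq (p q : R * R -> R) : measurable_fun setT p -> measurable_fun setT q ->
  J.-integrable setT (EFin \o (fun z => p (z.1, chan s z))) ->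
  J.-integrable setT (EFin \o (fun z => q (z.1, chan s z))) ->
  (forall w, mu.-integrable setT (EFin \o (fun x => p (x, w) * lik r w x))) ->
  (forall w, mu.-integrable setT (EFin \o (fun x => q (x, w) * lik r w x))) ->
  (forall w, (\int[mu]_x (p (x, w) * lik r w x))%R = (\int[mu]_x (q (x, w) * lik r w x))%R) ->
  (\int[J]_z (p (z.1, chan s z)))%R = (\int[J]_z (q (z.1, chan s z)))%R.
Proof.
move=> mp mq ip iq lp lq E.
pose a (z : R * R) : R := `|p z| + `|q z|.
have ma : measurable_fun setT a by apply: measurable_funD; exact: measurableT_comp.
have ia : J.-integrable setT (EFin \o (fun z => a (z.1, chan s z))).
  by apply: integrable_add; [exact: integrable_norm ip|exact: integrable_norm iq].
have la w : mu.-integrable setT (EFin \o (fun x => a (x, w) * lik r w x)).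
  have := integrable_add _ _ _ (integrable_norm (lp w)) (integrable_norm (lq w)).
  apply: eq_integrable => // x _ /=.
  by rewrite !normrM !(ger0_norm (ltW (lik_gt0 _ _ _))) -mulrDl.
have step (h : R * R -> R) : measurable_fun setT h -> (forall z, 0 <= h z + a z) ->
    J.-integrable setT (EFin \o (fun z => h (z.1, chan s z))) ->
    (forall w, mu.-integrable setT (EFin \o (fun x => h (x, w) * lik r w x))) ->
    ((\int[J]_z (h (z.1, chan s z)))%R + (\int[J]_z (a (z.1, chan s z)))%R)%:E =
    (\int[gamma]_w ((\int[mu]_x (h (x, w) * lik r w x))%R + (\int[mu]_x (a (x, w) * lik r w x))%R)%:E)%E.
  move=> mh h0 ih lh; rewrite -RintegralD // /Rintegral fineK; last first.
    by apply: integrable_fin_num => //; exact: integrable_add.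
  rewrite (ge0_integral_chan (fun z => (h z + a z)%:E)) //; last first.
  - by apply/measurable_EFinP; exact: measurable_funD.
  apply: eq_integral => w _.
  rewrite -/(Rintegral mu setT (fun x => h (x, w) * lik r w x)).
  rewrite -/(Rintegral mu setT (fun x => a (x, w) * lik r w x)) -RintegralD // /Rintegral fineK; last first.
    by apply: integrable_fin_num => //; exact: integrable_add.
  by apply: eq_integral => x _; rewrite -EFinM mulrDl.
have p0 z : 0 <= p z + a z.
  by have := ler_norm (- p z); have := normr_ge0 (q z); rewrite normrN /a; lra.
have q0 z : 0 <= q z + a z.
  by have := ler_norm (- q z); have := normr_ge0 (p z); rewrite normrN /a; lra.
have := step p mp p0 ip lp; have := step q mq q0 iq lq.
under eq_integral do rewrite -E.
by move=> <- [] /addIr.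
Qed.

Hypothesis mi : forall n, mu.-integrable setT (EFin \o (fun x : R => x ^+ n)).
Local Notation Z := (tmom mu id r).
Let mid : measurable_fun setT (@id R). Proof. by []. Qed.

Definition bayes (w : R) : R := Z w 1%N / Z w 0%N.

Lemma measurable_bayes : measurable_fun setT bayes.
Proof.
apply: measurable_funM; first exact: measurable_tmom.
have -> : (fun w => (Z w 0%N)^-1) = (@powR R ^~ (-1)) \o (fun w => Z w 0%N).
  by apply/funext => w; rewrite /= powR_inv1 // ltW // tmom0_gt0.
by apply: measurableT_comp; [exact: measurable_powR|exact: measurable_tmom].
Qed.

Let bayesZ w : bayes w * Z w 0%N = Z w 1%N.
Proof. by rewrite divfK // gt_eqF // tmom0_gt0. Qed.

Lemma integrable_signal : J.-integrable setT (EFin \o (fun z : R * R => z.1)).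
Proof.
have m1 : measurable_fun setT (fun z : R * R => z.1%:E) by apply/measurable_EFinP; exact: measurable_fst.
apply/integrableP; split; first exact: m1.
rewrite (ge0_integral_chan (fun z => `|z.1%:E|)%E) //; last exact: measurableT_comp.
rewrite (eq_integral (fun w => (amom mu id r w 1)%:E)).
  rewrite ge0_integral_amom //.
  by have := integrable_lty measurableT (abs_moment_fin mu id mi 1).
move=> w _; rewrite /amom /Rintegral fineK; last exact: (integrable_fin_num measurableT (integrable_amom mu id mid mi r w 1)).
by apply: eq_integral => x _; rewrite expr1 EFinM.
Qed.

Lemma integrable_bayes_chan : J.-integrable setT (EFin \o (fun z => bayes (chan s z))).
Proof.
have mb : measurable_fun setT (fun z : R * R => bayes (chan s z)).
  exact: (measurableT_comp measurable_bayes measurable_chan).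
apply/integrableP; split; first by apply/measurable_EFinP; exact: mb.
rewrite (ge0_integral_chan (fun z => `|(bayes z.2)%:E|)%E) //; last first.
  by apply: measurableT_comp => //; apply/measurable_EFinP; exact: (measurableT_comp measurable_bayes).
have := integrable_norm (integrable_gauss_amom mu id mid mi r 1).
move=> /(integrable_lty measurableT); apply: le_lt_trans.
apply: ge0_le_integral => //.
- move=> w _; apply: integral_ge0 => x _.
  by rewrite mule_ge0 // lee_fin ltW // lik_gt0.
- apply: (measurable_fun_fubini_tonelli_F (fun z : R * R => `|(bayes z.1)%:E| * (lik r z.1 z.2)%:E)%E).
    apply: emeasurable_funM; last by apply/measurable_EFinP; exact: measurable_lik.
    by apply: measurableT_comp => //; apply/measurable_EFinP; exact: (measurableT_comp measurable_bayes).
  by move=> z; rewrite mule_ge0 // lee_fin ltW // lik_gt0.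
- by apply/measurable_EFinP; apply: measurableT_comp => //; exact: measurable_amom.
move=> w _; rewrite /= ge0_integralZl //; first last.
- by move=> x _; rewrite lee_fin ltW // lik_gt0.
- by apply/measurable_EFinP; exact: measurable_lik.
have -> : (\int[mu]_x (lik r w x)%:E = (Z w 0%N)%:E)%E.
  rewrite /tmom /Rintegral fineK; last exact: (integrable_fin_num measurableT (integrable_tmom mu id mid mi r w 0)).
  by apply: eq_integral => x _; rewrite expr0 mul1r.
rewrite -EFinM lee_fin /= -[Z w 0%N]gtr0_norm ?tmom0_gt0 // -normrM bayesZ.
by rewrite (le_trans (tmom_le_amom _ _ mid mi _ _ _)) // ler_norm.
Qed.

(** After the change of density the indicator of B depends on w alone and leaves the integral over
    x; what remains is that [bayes] times [Z w 0] is [Z w 1]. *)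
Lemma is_condexp_bayes : is_condexp mu s bayes.
Proof.
split; first exact: measurable_bayes.
  exact: integrable_bayes_chan.
move=> B mB.
have mcB : measurable (chan s @^-1` B) by rewrite -[X in measurable X]setTI; exact: measurable_chan.
have mi2 : measurable_fun setT (fun z : R * R => \1_B z.2 : R).
  by apply: (measurableT_comp _ measurable_snd); exact: measurable_indic.
have mi2c : measurable_fun setT (fun z : R * R => \1_B (chan s z) : R).
  by apply: (measurableT_comp _ measurable_chan); exact: measurable_indic.
have i01 (h : R * R -> R) : measurable_fun setT h -> J.-integrable setT (EFin \o h) ->
    J.-integrable setT (EFin \o (fun z => \1_B (chan s z) * h z)).
  move=> mh ih; apply: (dominated_integrable _ _ _ _ _ (fun z => `|h z|)).
  - exact: measurable_funM.
  - move=> z; rewrite normrM ler_piMl // indicE; case: (_ \in _); by rewrite ?normr1 ?normr0.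
  - exact: integrable_norm ih.
have rE (h : R * R -> R) : J.-integrable setT (EFin \o (fun z => \1_B (chan s z) * h z)) ->
    (\int[J]_(z in chan s @^-1` B) (h z)%:E)%E = ((\int[J]_z (\1_B (chan s z) * h z))%R)%:E.
  move=> ih; rewrite integral_mkcond /Rintegral fineK; last exact: integrable_fin_num ih.
  apply: eq_integral => z _; rewrite patchE indicE.
  have -> : (z \in chan s @^-1` B) = (chan s z \in B) by apply/idP/idP; rewrite !inE.
  by case: (_ \in B); rewrite ?mul1r ?mul0r.
have mbc : measurable_fun setT (fun z : R * R => bayes (chan s z)).
  exact: (measurableT_comp measurable_bayes measurable_chan).
have ix := i01 (fun z => z.1) measurable_fst integrable_signal.
have ib := i01 _ mbc integrable_bayes_chan.
rewrite /joint (rE (fun z => z.1) ix) (rE (fun z => bayes (chan s z)) ib); congr (_%:E).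
have lx w : mu.-integrable setT (EFin \o (fun x => x * lik r w x)).
  by have := integrable_tmom mu id mid mi r w 1; apply: eq_integrable => // x _; rewrite /= expr1.
have l0 w : mu.-integrable setT (EFin \o (fun x => lik r w x)).
  by have := integrable_tmom mu id mid mi r w 0; apply: eq_integrable => // x _; rewrite /= expr0 mul1r.
apply: (integral_chan_eq (fun z => \1_B z.2 * z.1) (fun z => \1_B z.2 * bayes z.2)) => //.
- exact: measurable_funM.
- exact: (measurable_funM mi2 (measurableT_comp measurable_bayes measurable_snd)).
- move=> w /=; have := integrable_scale _ (\1_B w) _ (lx w).
  by apply: eq_integrable => // x _; rewrite /= mulrA.
- move=> w /=; exact: integrable_scale.
move=> w /=.
transitivity (\1_B w * Z w 1%N).
  rewrite /tmom -RintegralZl //.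
  by apply: eq_Rintegral => x _; rewrite expr1 mulrA.
rewrite -bayesZ mulrA /tmom -RintegralZl //; last exact: (integrable_tmom mu id mid mi r w 0).
by apply: eq_Rintegral => x _; rewrite expr0 mul1r.
Qed.

(** Existence of a version rules out the default value 0 of [condexp]. *)
Lemma condexpP : is_condexp mu s (condexp mu s).
Proof.
rewrite /condexp; case: pselect => [H|nH]; first exact: projT2 (cid H).
by case: nH; exists bayes; exact: is_condexp_bayes.
Qed.

(** Both versions have the same integral over every measurable set of observations, so they agree
    almost everywhere for the law [nu] of Y_s; the exceptional set is pulled back along [chan s]. *)
Lemma condexp_ae : ae_eq J setT (fun z => (condexp mu s (chan s z))%:E) (fun z => (bayes (chan s z))%:E).
Proof.
have [mg ig eg] := condexpP; have [mb ib eb] := is_condexp_bayes.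
have mch := measurable_chan.
pose nu : {measure set R -> \bar R} :=
  measure_function_pushforward__canonical__measure_function_Measure J mch.
have mg' : measurable_fun setT (EFin \o condexp mu s) by exact/measurable_EFinP.
have mb' : measurable_fun setT (EFin \o bayes) by exact/measurable_EFinP.
have : ae_eq nu setT (EFin \o condexp mu s) (EFin \o bayes).
  apply: integral_ae_eq => //.
    exact: (integrable_pushforward mch mg' ig measurableT).
  move=> E _ mE.
  have mcE : measurable (chan s @^-1` E) by rewrite -[X in measurable X]setTI; exact: measurable_chan.
  rewrite /nu /= (integral_pushforward mch mg') //; last exact: (integrableS measurableT).
  rewrite (integral_pushforward mch mb') //; last exact: (integrableS measurableT).
  by rewrite /comp -eg // -eb.
move=> [N [mN N0 sN]]; exists (chan s @^-1` N); split => //.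
  by rewrite -[X in measurable X]setTI; exact: measurable_chan.
by move=> z /= Hz; apply: sN => /= H; apply: Hz => _; exact: H.
Qed.

(** Minus u_1 is the second posterior cumulant, hence the posterior variance, here weighted by the
    density of the observation. *)
Lemma pweight_var w : - pweight mu id r w [:: 1%N] =
  (\int[mu]_x ((x - bayes w) ^+ 2 * lik r w x))%R.
Proof.
have it n : mu.-integrable setT (EFin \o (fun x => x ^+ n * lik r w x)).
  exact: (integrable_tmom mu id mid mi r w n).
transitivity (Z w 2%N - 2%:R * bayes w * Z w 1%N + bayes w ^+ 2 * Z w 0%N); last first.
  have i1 := integrable_scale _ (2%:R * bayes w) _ (it 1%N).
  have i0 := integrable_scale _ (bayes w ^+ 2) _ (it 0%N).
  have i21 := integrable_sub _ _ _ (it 2%N) i1.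
  rewrite /tmom -(RintegralZl _ measurableT (it 1%N)) -(RintegralZl _ measurableT (it 0%N)).
  rewrite -(RintegralB measurableT (it 2%N) i1) -(RintegralD measurableT i21 i0).
  by apply: eq_Rintegral => x _; rewrite /= expr1 expr0; ring.
have Z0 : Z w 0%N != 0 by rewrite gt_eqF // tmom0_gt0.
rewrite /pweight /wprod /mprod big_seq1 ncumE big_ord1 /= bin0 subn0 mul1r ncumE big_ord0.
by rewrite /posterior /bayes; field.
Qed.

Theorem mmseE : mmse mu s = (- pavg mu id r [:: 1%N])%:E.
Proof.
have [mg _ _] := condexpP; have mb := measurable_bayes; have mch := measurable_chan.
have msq (g : R -> R) : measurable_fun setT g ->
    measurable_fun setT (fun z : R * R => ((z.1 - g (chan s z)) ^+ 2)%:E).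
  move=> mgg; apply/measurable_EFinP; apply: measurable_funX; apply: measurable_funB => //.
  exact: (measurableT_comp mgg mch).
transitivity (\int[J]_z ((z.1 - bayes (chan s z)) ^+ 2)%:E)%E.
  rewrite /mmse /joint; apply: ge0_ae_eq_integral => //.
  - exact: msq.
  - exact: msq.
  - by move=> z _; rewrite lee_fin sqr_ge0.
  - by move=> z _; rewrite lee_fin sqr_ge0.
  - apply: filterS condexp_ae => z H zT; have [->] := H zT; by [].
rewrite (ge0_integral_chan (fun z => ((z.1 - bayes z.2) ^+ 2)%:E)); first last.
- by move=> z; rewrite lee_fin sqr_ge0.
- apply/measurable_EFinP; apply: measurable_funX; apply: measurable_funB => //.
  exact: (measurableT_comp mb).
have ip := integrable_pweight mu id mid mi r [:: 1%N].
transitivity (\int[gamma]_w (-1 * pweight mu id r w [:: 1%N])%:E)%E.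
  apply: eq_integral => w _; rewrite mulN1r pweight_var /Rintegral fineK.
    by apply: eq_integral => x _; rewrite -EFinM.
  apply: integrable_fin_num => //.
  apply: (eq_integrable _ (EFin \o (fun x => (x ^+ 2 * lik r w x - 2%:R * bayes w * (x ^+ 1 * lik r w x))
     + bayes w ^+ 2 * (x ^+ 0 * lik r w x)))) => //.
    by move=> x _; rewrite /= expr1 expr0; congr (_%:E); ring.
  have it n := integrable_tmom mu id mid mi r w n.
  by apply: integrable_add; [apply: integrable_sub; [exact: it|]|]; try apply: integrable_scale; exact: it.
have -> : - pavg mu id r [:: 1%N] = (\int[gamma]_w (-1 * pweight mu id r w [:: 1%N]))%R.
  by rewrite (RintegralZl _ measurableT ip) mulN1r.
rewrite /Rintegral fineK //.
by apply: integrable_fin_num => //; exact: integrable_scale.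
Qed.

End channel.

(** * Cumulants as derivatives of the logarithm of the characteristic function *)

Section characteristic_function.
Context {R : realType}.
Variable mu : probability R R.
Hypothesis mi : forall n, mu.-integrable setT (EFin \o (fun x : R => x ^+ n)).

(** The n-th derivative of [cos]; its sign changes at every odd n, whence [uphalf]. *)
Definition dcos (n : nat) (y : R) : R := (-1) ^+ uphalf n * (if odd n then sin y else cos y).

Lemma is_derive_dcos n (y : R) : is_derive y 1 (dcos n) (dcos n.+1 y).
Proof.
rewrite /dcos; have -> : uphalf n.+1 = (~~ odd n + uphalf n)%N.
  by rewrite /= uphalf_half; case: (odd n); rewrite ?add0n ?add1n.
rewrite [odd n.+1]/=; case: (odd n) => /=.
  rewrite (_ : (fun _ => _) = cst ((-1) ^+ uphalf n) * sin) //.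
  by apply: is_derive_eq; rewrite /GRing.scale /= add0n; ring.
rewrite (_ : (fun _ => _) = cst ((-1) ^+ uphalf n) * cos) //.
by apply: is_derive_eq; rewrite /GRing.scale /= add1n exprS; ring.
Qed.

Lemma dcos_le1 n y : `|dcos n y| <= 1.
Proof.
rewrite normrM normrX normrN1 expr1n mul1r.
by case: ifP => _; rewrite ler_norml; [rewrite sin_geN1 sin_le1|rewrite cos_geN1 cos_le1].
Qed.

Lemma measurable_dcos n : measurable_fun setT (dcos n).
Proof.
apply: continuous_measurable_fun => y.
by apply: differentiable_continuous; apply/derivable1_diffP; have := is_derive_dcos n y; case.
Qed.

Definition dphi (n : nat) (t : R) : R := (\int[mu]_x (x ^+ n * dcos n (t * x)))%R.

Lemma measurable_dphi_fun n t : measurable_fun setT (fun x : R => x ^+ n * dcos n (t * x)).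
Proof.
apply: measurable_funM => //; apply: measurableT_comp; first exact: measurable_dcos.
exact: measurable_funM.
Qed.

Lemma is_derive_dphi n (t : R) : is_derive t 1 (dphi n) (dphi n.+1 t).
Proof.
apply: (is_derive_Rintegral _ _ _ _ (fun t x : R => x ^+ n * dcos n (t * x))
  (fun t x : R => x ^+ n.+1 * dcos n.+1 (t * x)) (fun x : R => `|x ^+ n.+1|)).
- move=> s; apply: (dominated_integrable _ _ _ _ _ (fun x : R => `|x ^+ n|)).
  + exact: measurable_dphi_fun.
  + by move=> x; rewrite normrM ler_piMr // dcos_le1.
  + exact: (integrable_norm (mi n)).
- move=> s x.
  have hd : is_derive s 1 (fun s : R => s * x) x.
    rewrite (_ : (fun _ => _) = id * cst x) //.
    by apply: is_derive_eq; rewrite /GRing.scale /=; ring.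
  have hc := @is_derive1_comp R (dcos n) (fun s : R => s * x) s _ _ (is_derive_dcos n (s * x)) hd.
  rewrite (_ : (fun _ => _) = cst (x ^+ n) * (dcos n \o (fun s : R => s * x))) //.
  by apply: is_derive_eq; rewrite /GRing.scale /= exprS; ring.
- exact: (integrable_norm (mi n.+1)).
- by move=> s x _; rewrite normrM ler_piMr // dcos_le1.
Qed.

Lemma charfun_symE : charfun_sym mu = dphi 0.
Proof.
apply/funext => t; rewrite /charfun_sym /dphi /Rintegral; congr fine.
by apply: eq_integral => x _; rewrite /dcos !expr0 !mul1r.
Qed.

(** The derivatives Z_n of phi satisfy Z_n' = Z_{n+1}, the flow with a = 1 and b = 0, along which
    [ncum] moves from n to n + 1. The calculus made for posterior cumulants thus applies with t as
    time. *)
Lemma derive1n_ln_charfun n t : 0 < dphi 0 t ->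
  derive1n n.+1 (fun t => ln (charfun_sym mu t)) t = - ncum (posterior (dphi ^~ t)) n.
Proof.
rewrite charfun_symE; elim: n t => [|n IH] t t0.
  rewrite derive1n1 derive1E ncumE big_ord0 subr0 opprK.
  have d0 := is_derive_dphi 0 t.
  have hl := is_derive1_comp (is_derive1_ln t0) d0.
  by rewrite (@derive_val _ _ _ _ _ _ _ hl) /posterior mulrC.
rewrite derive1nS derive1E.
have d0 := is_derive_dphi 0 t.
(* The induction hypothesis holds where phi is positive, and differentiating it requires a
   neighbourhood. *)
have near0 : \forall s \near t, 0 < dphi 0 s.
  have ct : {for t, continuous (dphi 0)}.
    by apply: differentiable_continuous; apply/derivable1_diffP; case: d0.
  by apply: (cvgr_gt _ ct).
have Z0 : dphi 0 t != 0 by rewrite gt_eqF.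
have dZ k : is_derive t 1 (fun s => dphi k s) (1 * dphi k.+1 t + 0 * dphi k.+2 t).
  by rewrite mul1r mul0r addr0; exact: is_derive_dphi.
have dm := is_derive_posterior (fun s n => dphi n s) t 1 0 Z0 dZ.
have m0 : posterior (dphi ^~ t) 0 = 1 by rewrite /posterior divff.
have du := is_derive_ncum (fun s => posterior (dphi ^~ s)) t 1 0 m0 dm n.
have dN := is_deriveN du.
rewrite (near_eq_derive _ (g := - (fun s => ncum (posterior (dphi ^~ s)) n))).
- by rewrite (@derive_val _ _ _ _ _ _ _ dN) mul1r mul0r addr0.
- by apply: filterS near0 => s; exact: IH.
Qed.

Local Notation m := (fun n => (\int[mu]_x (x ^+ n))%R).

Lemma moment0 : m 0%N = 1.
Proof. by rewrite -[RHS](Rintegral_prob_cst mu); apply: eq_Rintegral => x _; rewrite expr0. Qed.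

Lemma dphi_at0 n : dphi n 0 = (-1) ^+ n./2 * (~~ odd n)%:R * m n.
Proof.
rewrite /dphi -RintegralZl //; apply: eq_Rintegral => x _.
rewrite /dcos mul0r sin0 cos0 uphalf_half; case: (odd n) => /=; last by rewrite add0n; ring.
by ring.
Qed.

Hypothesis msym : symmetric_law mu.

Lemma odd_moment n : odd n -> m n = 0.
Proof.
move=> on; have mo : measurable_fun [set: R] (-%R : R -> R) by exact: measurable_funN.
have E : (\int[mu]_x (x ^+ n)%:E = \int[mu]_x ((- x) ^+ n)%:E)%E.
  pose nu : {measure set R -> \bar R} :=
    measure_function_pushforward__canonical__measure_function_Measure mu mo.
  transitivity (\int[nu]_x (x ^+ n)%:E)%E.
    by apply: eq_measure_integral => A mA _; rewrite /nu /= /pushforward msym.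
  have mx : measurable_fun setT (fun x : R => (x ^+ n)%:E) by apply/measurable_EFinP.
  have ix : mu.-integrable (-%R @^-1` [set: R]) ((fun x : R => (x ^+ n)%:E) \o -%R).
    rewrite preimage_setT.
    apply: (dominated_integrable _ _ _ _ _ (fun x : R => `|x ^+ n|)).
    - by apply: measurable_funX.
    - by move=> x /=; rewrite !normrX normrN.
    - exact: (integrable_norm (mi n)).
  by rewrite /nu /= (integral_pushforward mo mx ix measurableT) preimage_setT.
have : m n = - m n.
  rewrite {1}/Rintegral E -/(Rintegral mu setT (fun x => (- x) ^+ n)) -mulN1r.
  rewrite -(RintegralZl _ measurableT (mi n)).
  apply: eq_Rintegral => x _; rewrite exprNn -signr_odd on expr1.
  by [].
by lra.
Qed.

Lemma even_ncum n : ~~ odd n -> ncum m n = 0.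
Proof.
have [k] := ubnP n; elim: k n => // k IH n; rewrite ltnS => nk en.
rewrite ncumE odd_moment //= big1 ?subr0 ?oppr0 // => j _.
have [oj|ej] := boolP (odd j); last by rewrite IH ?mulr0 ?mul0r // (leq_trans (ltn_ord j)).
by rewrite odd_moment ?mulr0 // oddB ?oj ?(ltnW (ltn_ord j)) // (negbTE en).
Qed.

(** The index is shifted because [ncum] at i stands for cumulant i + 1. At 0 the derivatives of phi
    are moments with signs, the odd ones being 0; uniqueness in the recursion transfers the signs to
    the cumulants, where they cancel (-1)^n. *)
Lemma even_cumulant_symE n : (0 < n)%N -> even_cumulant_sym mu n = - ncum m (2 * n).-1.
Proof.
case: n => // n _; rewrite /even_cumulant_sym (_ : (2 * n.+1 = (2 * n).+1.+1)%N) ?mulnS //.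
rewrite succnK.
have f0 : dphi 0 0 = 1 by rewrite dphi_at0 /= moment0 !mulr1.
rewrite derive1n_ln_charfun ?f0 //.
have pE : posterior (dphi ^~ 0) = dphi ^~ 0.
  by apply/funext => k; rewrite /posterior f0 divr1.
rewrite pE.
have fE k : dphi k 0 = (-1) ^+ k./2 * m k.
  rewrite dphi_at0; case: (boolP (odd k)) => ok; last by rewrite /= mulr1.
  by rewrite odd_moment // !mulr0.
have -> : ncum (dphi ^~ 0) = fun i => (-1) ^+ uphalf i * ncum m i.
  apply/esym/funext; apply: ncum_unique => // k.
  have mS := bshift_ncum m moment0 k; rewrite /bshift in mS.
  rewrite fE mS !bconvE mulrN; congr (- _); rewrite mulr_sumr; apply: eq_bigr => j _.
  rewrite fE.
  have [oj|ej] := boolP (odd j); last by rewrite (even_ncum j) // !(mulr0, mul0r).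
  have [okj|ekj] := boolP (odd (k - j)); first by rewrite odd_moment // !mulr0.
  have jk : (j <= k)%N by rewrite -ltnS.
  have -> : (k.+1./2 = uphalf j + (k - j)./2)%N.
    by move: oj ekj jk; move: (nat_of_ord j) => i; clear; lia.
  by rewrite exprD; ring.
rewrite (_ : uphalf (2 * n).+1 = n.+1); last by rewrite /= mul2n doubleK.
by rewrite mulrN mulrA -exprD addnn -mul2n exprM sqrrN expr1n expr1n mul1r.
Qed.

End characteristic_function.

(** * Equality of the laws *)

Lemma moment_Rintegral (R : realType) (mu : probability R R) n :
  mu.-integrable setT (EFin \o (fun x : R => x ^+ n)) -> moment mu n = ((\int[mu]_x (x ^+ n))%R)%:E.
Proof. by move=> i; rewrite /moment /Rintegral fineK //; exact: integrable_fin_num. Qed.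

Theorem law_eq_of_mmse (R : realType) (mu nu : probability R R) :
  SMD mu -> (forall n, (1 <= n)%N -> 0 < even_cumulant_sym mu n) ->
  has_all_moments nu -> (\int[nu]_x x)%R = 0 ->
  (forall s, 0 < s -> mmse mu s = mmse nu s) ->
  forall A, measurable A -> mu A = nu A.
Proof.
move=> [msym mi mdet] kpos ni n1 E.
pose m n := (\int[mu]_x (x ^+ n))%R; pose m' n := (\int[nu]_x (x ^+ n))%R.
have avgE r : 0 < r -> pavg mu id r [:: 1%N] = pavg nu id r [:: 1%N].
  move=> r0; have := E (r ^+ 2) (exprn_gt0 _ r0).
  rewrite (mmseE mu _ mi) (mmseE nu _ ni) sqrtr_sqr (gtr0_norm r0).
  by case=> /oppr_inj.
have mid : measurable_fun setT (@id R) by [].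
have flowE := flow_of_pavg _ _ _ _ _ mu nu id id mid mi mid ni avgE.
have uE : ncum m =1 ncum m'.
  apply: ncum_eq_of_flow => //.
  (* The mmse is invariant under translation and cannot see the mean; symmetry of X and centring of
     Y settle index 0. *)
  - have m1 : m 1%N = 0 by exact: (odd_moment mu mi msym 1).
    have m'1 : m' 1%N = 0 by rewrite -[RHS]n1; apply: eq_Rintegral => x _; rewrite expr1.
    by rewrite !ncumE !big_ord0 m1 m'1.
  - by move=> i ei; exact: even_ncum.
  - move=> i oi; have i0 : (0 < uphalf i)%N by rewrite uphalf_half oi.
    have iE : ((2 * uphalf i).-1 = i)%N by move: oi; clear; lia.
    by have := kpos _ i0; rewrite even_cumulant_symE // iE oppr_gt0.
have mE := ncum_inj m m' (moment0 mu) (moment0 nu) uE.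
move=> A mA; apply/esym; apply: mdet => // p _; split; first exact: ni.
by rewrite (moment_Rintegral _ nu p (ni p)) (moment_Rintegral _ mu p (mi p)) -/(m p) mE.
Qed.

(** All hypotheses except the centring already concern laws; that one is carried over by the change
    of variables for [distribution]. *)
Theorem theorem2p8 (R : realType)
    (d1 : measure_display) (T1 : measurableType d1) (P1 : probability T1 R)
    (X : {RV P1 >-> R})
    (d2 : measure_display) (T2 : measurableType d2) (P2 : probability T2 R)
    (Y : {RV P2 >-> R}) :
  SMD (distribution P1 X) ->
  (forall n : nat, (1 <= n)%N -> 0 < even_cumulant_sym (distribution P1 X) n) ->
  has_all_moments (distribution P2 Y) ->
  ('E_P2[Y] = 0)%E ->
  (forall s : R, 0 < s -> mmse (distribution P1 X) s = mmse (distribution P2 Y) s) ->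
  forall A : set R, measurable A -> distribution P1 X A = distribution P2 Y A.
Proof.
move=> smd kpos mY EY E; apply: law_eq_of_mmse => //.
rewrite /Rintegral -[RHS]/(fine 0%E) -EY expectation_def; congr fine.
have m1 : measurable_fun setT (fun x : R => x%:E) by apply/measurable_EFinP.
rewrite integral_distribution //.
apply/integrableP; split; first exact: (measurableT_comp m1).
have ma : measurable_fun setT (fun x : R => `|x%:E|%E) by exact: measurableT_comp.
rewrite -[X in (X < _)%E](ge0_integral_distribution Y ma) //.
have /integrableP[_] := mY 1%N.
by under eq_integral do rewrite expr1.
Qed.
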